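(* Let $\boldsymbol\alpha=(\alpha_1,\dots,\alpha_d)$, $\boldsymbol\beta=(\beta_1,\dots,\beta_d)$ be multisets of rational numbers with $\alpha_i\not\equiv\beta_j\pmod{\mathbb{Z}}$ for all $i,j$, and suppose there are positive integers $p_1,\dots,p_r,q_1,\dots,q_s$ with $\gcd(p_1,\dots,q_s)=1$ and $$\prod_{j=1}^d\frac{X-e^{2\pi i\alpha_j}}{X-e^{2\pi i\beta_j}}=\frac{\prod_{i=1}^r(X^{p_i}-1)}{\prod_{j=1}^s(X^{q_j}-1)}.$$ Let $q$ be a prime power such that $(q-1)\alpha_i,(q-1)\beta_j\in\mathbb{Z}$ for all $i,j$ and each $p_i$ and each $q_j$ divides $q-1$. Then for all $t\in\mathbb{F}_q^\times$, $$H_q(\boldsymbol\alpha,\boldsymbol\beta|t)=\frac{(-1)^{r+s}}{1-q}\sum_{m=0}^{q-2}q^{s(m)-s(0)}\prod_{i=1}^rg(p_im)\prod_{j=1}^sg(-q_jm)\,\omega(\epsilon M^{-1}t)^m,$$ where $M=\prod_ip_i^{p_i}\prod_jq_j^{-q_j}$, $\epsilon=(-1)^{\sum_jq_j}$, and $s(m)$ is the multiplicity of $e^{2\pi im/(q-1)}$ as a zero of $D(X)=\gcd\big(\prod_i(X^{p_i}-1),\prod_j(X^{q_j}-1)\big)$.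
   Context: Fix a nontrivial additive character $\psi_q$ of $\mathbb{F}_q$ and a generator $\omega$ of the character group of $\mathbb{F}_q^\times$; $g(m)=\sum_{x\in\mathbb{F}_q^\times}\omega(x)^m\psi_q(x)$ for $m\in\mathbb{Z}$. Write $\bar q=q-1$. The finite hypergeometric sum is $$H_q(\boldsymbol\alpha,\boldsymbol\beta|t)=\frac{1}{1-q}\sum_{m=0}^{q-2}\prod_{i=1}^d\frac{g(m+\alpha_i\bar q)\,g(-m-\beta_i\bar q)}{g(\alpha_i\bar q)\,g(-\beta_i\bar q)}\,\omega((-1)^dt)^m .$$ *)

(* Defs.v *)
From HB Require Import structures.
From mathcomp Require Import all_boot all_order all_algebra all_field.
Set Implicit Arguments. Unset Strict Implicit. Unset Printing Implicit Defensive.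
Import Order.TTheory GRing.Theory Num.Theory.
Local Open Scope ring_scope.

(* e^{2 pi i r} for a rational r = a/b (b = denq r > 0), computed in algC as
   (e^{i pi / b})^(2a), where b.-root (-1) is the b-th root of -1 of minimal
   non-negative argument, i.e. e^{i pi / b}. *)
Definition expi2pi (r : rat) : algC :=
  ((`|denq r|%N).-root (-1)) ^ (2 * numq r).

(* The integer represented by a rational number (used only for rationals that
   are integers, where r = (ratz r)%:~R). *)
Definition ratz (r : rat) : int := numq r.

Definition is_add_char (F : finFieldType) (psi : F -> algC) : Prop :=
  (forall x y : F, psi (x + y) = psi x * psi y) /\ (forall x, psi x != 0).

(* Multiplicative character F^x -> algC^x, represented as a function on F
   whose values on nonzero elements are what matters. *)
Definition is_mult_char (F : finFieldType) (chi : F -> algC) : Prop :=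
  (forall x y : F, x != 0 -> y != 0 -> chi (x * y) = chi x * chi y) /\
  (forall x : F, x != 0 -> chi x != 0).

Definition generates_char_group (F : finFieldType) (omega : F -> algC) : Prop :=
  is_mult_char omega /\
  forall chi : F -> algC, is_mult_char chi ->
    exists k : nat, forall x : F, x != 0 -> chi x = omega x ^+ k.

Definition gauss (F : finFieldType) (psi omega : F -> algC) (m : int) : algC :=
  \sum_(x : F | x != 0) omega x ^ m * psi x.

Definition Hq (F : finFieldType) (psi omega : F -> algC) (d : nat)
    (alpha beta : 'I_d -> rat) (t : F) : algC :=
  let q := #|F| in
  let qb : rat := (q.-1)%:R in
  (1 - q%:R)^-1 *
  \sum_(0 <= m < q.-1)
    (\prod_(i < d)
        (gauss psi omega (m%:Z + ratz (alpha i * qb)) *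
         gauss psi omega (- m%:Z - ratz (beta i * qb)) /
         (gauss psi omega (ratz (alpha i * qb)) *
          gauss psi omega (- ratz (beta i * qb))))) *
    omega ((-1) ^+ d * t) ^ (m%:Z).

(* Main.v *)
(** Since g(u) g(-u) is omega(-1)^u q or 1, the m-th term of H_q is an explicit
    factor times the quotient of the products of g(m + a) / g(a) over the
    a = (q-1) alpha_j and over the a = (q-1) beta_j.  The polynomial identity
    turns this into the same quotient over the exponents of the roots of the
    X^(p_i) - 1 and of the X^(q_j) - 1, and the Hasse-Davenport product formula
    evaluates the factor of each p_i and q_j.  The powers of q are collected by
    comparing multiplicities of roots of unity.

    The product formula comes from L-functions.  For monic f over F_q put
    Lambda(f) = chi^n((-1)^deg(f) f(0)) psi(p_n(f)), with p_n(f) the sum of the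
    n-th powers of the roots of f.  The number of solutions of y^n = x in
    F_(q^j) is the sum over the characters rho of order dividing n of
    rho(N(x)), so the L-function of Lambda is the product of the polynomials
    1 + g(chi rho) T.  Its coefficient of T^n is the sum of Lambda over monic f
    of degree n; as p_n(f) is -n f(0) plus a function of the other
    coefficients, that sum is chi(n)^(-n) g(chi^n) times a constant which does
    not depend on chi, hence can be read off at chi = 1. *)

Require Import Defs.
From HB Require Import structures.
From mathcomp Require Import all_boot all_order all_algebra cyclic all_field qpoly.
From mathcomp Require Import ring zify.
Set Implicit Arguments. Unset Strict Implicit. Unset Printing Implicit Defensive.
Import Order.TTheory GRing.Theory Num.Theory.
Local Open Scope ring_scope.

(** * Roots of unity and [expi2pi] *)

Lemma norm1_root (z : algC) n : (0 < n)%N -> `|z ^+ n| = 1 -> `|z| = 1.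
Proof. by move=> n0 /eqP; rewrite normrX pexpr_eq1 // => /eqP. Qed.

(** [n.-root] maximizes the real part only among the roots in the closed upper half plane; a root
    below the axis is replaced by its conjugate, again a root of -1 with the same real part. *)
Lemma rootCN1_Re_max n (z : algC) : (0 < n)%N -> z ^+ n = -1 ->
  'Re z <= 'Re (n.-root (-1)).
Proof.
move=> n0 zn; have [Iz|Iz] := real_ge0P (Creal_Im z).
  exact: rootC_Re_max.
rewrite -Re_conj; apply: rootC_Re_max => //.
  by rewrite -rmorphXn zn rmorphN1.
by rewrite Im_conj oppr_ge0 ltW.
Qed.

(** The roots of -1 sum to 0 when [n > 1], whereas a negative largest real part would make the real
    parts sum to something negative. *)
Lemma rootCN1_Re_ge0 n : (1 < n)%N -> 0 <= 'Re (n.-root (-1) : algC).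
Proof.
move=> n1; have n0 := ltnW n1; have [w pw] := C_prim_root_exists n0.
have realR : 'Re (n.-root (-1) : algC) \is Num.real by apply: Creal_Re.
rewrite real_leNgt ?rpred0 //; apply/negP => lt0.
have s0 : \sum_(i < n) (n.-root (-1) * w ^+ i) = 0 :> algC.
  rewrite -mulr_sumr; have /eqP := subrX1 w n; rewrite (prim_expr_order pw) subrr.
  rewrite eq_sym mulf_eq0 subr_eq0 (_ : w == 1 = false) /= => [/eqP->|].
    by rewrite mulr0.
  apply/negP => /eqP w1; move: pw; rewrite w1 => /prim_order_dvd/(_ 1%N).
  by rewrite expr1n eqxx dvdn1 => /eqP h; rewrite h in n1.
have : \sum_(i < n) 'Re (n.-root (-1) * w ^+ i : algC) < 0.
  rewrite -(big_mkord xpredT (fun i => 'Re (n.-root (-1) * w ^+ i : algC))).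
  rewrite big_ltn // expr0 mulr1 ltr_wnDr // sumr_le0 // => i _.
  apply: le_trans (ltW lt0); apply: rootCN1_Re_max => //.
  by rewrite exprMn rootCK // -exprM mulnC exprM (prim_expr_order pw) expr1n mulr1.
by rewrite -raddf_sum s0 raddf0 ltxx.
Qed.

(** Put y = e^(i theta) with 0 < theta <= pi/2 and z = e^(i phi). The last two inequalities say sin
    theta sin phi >= 0 and sin (theta - phi) >= 0, hence 0 <= phi <= theta, and the bound on real
    parts gives theta <= phi. The proof carries this out in coordinates. *)
Lemma unit_circle_arg_eq (y z : algC) : `|y| = 1 -> `|z| = 1 -> y != 1 ->
  0 <= 'Re y -> 0 <= 'Im y -> 'Re z <= 'Re y ->
  'Re (z * y) <= 'Re (y * z^*) -> 0 <= 'Im (y * z^*) -> z = y.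
Proof.
move=> y1 z1 yN1 a0 b0 le1 le2 I0.
have ReM u v : 'Re (u * v) = 'Re u * 'Re v - 'Im u * 'Im v :> algC.
  rewrite [u in LHS]Crect [v in LHS]Crect mulC_rect.
  by rewrite !(Re_rect, rpredB, rpredD, rpredM).
have := normC2_Re_Im y; have := normC2_Re_Im z; rewrite y1 z1 expr1n => z2 y2.
move: le2 I0; rewrite ReM ImM ReM !Re_conj !Im_conj => le2 I0.
have ra : 'Re y \is Num.real by []. have rb : 'Im y \is Num.real by [].
have re : 'Re z \is Num.real by []. have rf : 'Im z \is Num.real by [].
suff [E1 E2] : 'Re z = 'Re y /\ 'Im z = 'Im y by rewrite [z]Crect E1 E2 -Crect.
have {yN1} bN0 : 'Im y != 0.
  apply: contra_neq yN1 => b00; rewrite [y]Crect b00 mulr0 addr0.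
  move: y2; rewrite b00 expr0n addr0 => /esym/eqP.
  by rewrite -[X in _ == X](expr1n _ 2) eqrXn2 // => /eqP.
move: ('Re y) ('Im y) ('Re z) ('Im z) ra rb re rf bN0 y2 z2 a0 b0 le1 le2 I0.
move=> a b e f ra rb re rf bN0 y2 z2 a0 b0 ea le2 I0.
have bp : 0 < b by rewrite lt_def bN0.
have f0 : 0 <= f.
  rewrite -(pmulr_rge0 _ bp); move: le2.
  rewrite mulrN opprK (mulrC e) (mulrC f) lerD2l => /(fun h => h).
  by rewrite -subr_ge0 opprK -mulr2n pmulrn_lge0.
have afbe : a * f <= b * e by rewrite -subr_ge0; move: I0; rewrite mulrN addrC (mulrC e).
have e0 : 0 <= e by rewrite -(pmulr_rge0 _ bp); apply: le_trans afbe; apply: mulr_ge0.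
have bf : b <= f.
  rewrite -(@ler_pXn2r _ 2) ?nnegrE // -(lerD2l (a ^+ 2)) -y2 z2 lerD2r.
  by rewrite ler_pXn2r ?nnegrE.
have ae : a <= e.
  rewrite -(ler_pM2l bp); apply: le_trans afbe; rewrite mulrC.
  exact: ler_wpM2l.
have Eae : e = a by apply/eqP; rewrite eq_le ea.
split=> //; apply/eqP; rewrite -(@eqrXn2 _ 2) //.
by move/eqP: z2; rewrite y2 Eae (inj_eq (addrI _)) eq_sym.
Qed.

(* If [y ^+ 2] had order [c < n], let [u] have the largest real part among the
   n-th roots of unity outside <[y ^+ 2]>, say with Im u >= 0.
   Comparing [u] with [u / y ^+ 2] bounds its argument by that of [y], and
   then [y / u] is an n-th root of -1 with a larger real part than [y]. *)
Lemma rootCN1_sqr_primitive n : (0 < n)%N ->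
  n.-primitive_root (n.-root (-1) ^+ 2 : algC).
Proof.
move=> n0; have [n1|n1] := ltnP 1 n; last first.
  have -> : n = 1%N by apply/eqP; rewrite eqn_leq n1.
  rewrite root1C sqrrN expr1n; apply/andP; split=> //.
  by apply/forallP => i; rewrite ord1 unity_rootE expr1n !eqxx.
set y := n.-root (-1) : algC; have yn : y ^+ n = -1 by rewrite /y rootCK.
have y1 : `|y| = 1 by apply: (@norm1_root _ n) => //; rewrite yn normrN1.
have [c pc cn] : exists2 c, c.-primitive_root (y ^+ 2) & (c %| n)%N.
  have [|c pc cn] := @prim_order_exists _ n (y ^+ 2) n0; last by exists c.
  by rewrite exprAC yn sqrrN expr1n.
have [->|cneq] := eqVneq n c; first by [].
have cltn : (c < n)%N by rewrite ltn_neqAle eq_sym cneq dvdn_leq.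
have [w pw] := C_prim_root_exists n0.
have c0 := prim_order_gt0 pc.
have i1 : (w ^+ (Ordinal n1)) ^+ c != 1.
  by rewrite /= expr1 -(prim_order_dvd pw) gtnNdvd.
pose rr (i : 'I_n) := 'Re (w ^+ i).
have rrr i : rr i \is Num.real by apply: Creal_Re.
have [u [un uc umax uIm]] : exists u : algC, [/\ u ^+ n = 1, u ^+ c != 1,
   forall v, v ^+ n = 1 -> v ^+ c != 1 -> 'Re v <= 'Re u & 0 <= 'Im u].
  have [u [un uc umax]] : exists u : algC, [/\ u ^+ n = 1, u ^+ c != 1 &
     forall v, v ^+ n = 1 -> v ^+ c != 1 -> 'Re v <= 'Re u].
    have [|i ic im] := @real_arg_maxP algC 'I_n (Ordinal n1)
      (fun i => (w ^+ i) ^+ c != 1) rr i1; first by move=> *; apply: rrr.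
    exists (w ^+ i); split => //.
      by rewrite -exprM mulnC exprM (prim_expr_order pw) expr1n.
    move=> v vn vc; have [j vj] := prim_rootP pw vn.
    by rewrite vj; apply: im; rewrite -vj.
  have [Iu|Iu] := real_ge0P (Creal_Im u); first by exists u.
  exists u^*; split.
  - by rewrite -rmorphXn un rmorph1.
  - by rewrite -rmorphXn -(rmorph1 Num.conj) (inj_eq (inv_inj (@conjCK algC))).
  - by move=> v vn vc; rewrite Re_conj; apply: umax.
  - by rewrite Im_conj oppr_ge0 ltW.
have u1 : `|u| = 1 by apply: (@norm1_root _ n) => //; rewrite un normr1.
have yN0 : y != 0 by rewrite -normr_eq0 y1 oner_eq0.
have uN0 : u != 0 by rewrite -normr_eq0 u1 oner_eq0.
have le1 : 'Re (u * y^* ^+ 2) <= 'Re u.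
  apply: umax.
    by rewrite exprMn un mul1r exprAC -rmorphXn yn rmorphN1 sqrrN expr1n.
  by rewrite exprMn -!rmorphXn (prim_expr_order pc) rmorph1 mulr1.
have le2 : 'Re (y * u^*) <= 'Re y.
  by apply: rootCN1_Re_max => //; rewrite exprMn yn -rmorphXn un rmorph1 mulr1.
have a0 : 0 <= 'Re y by apply: rootCN1_Re_ge0.
have b0 : 0 <= 'Im y by apply: Im_rootC_ge0.
exfalso; move/eqP: uc; apply.
suff -> : u = 1 by rewrite expr1n.
suff E : y * u^* = y.
  have uc1 : u^* = 1 by apply: (mulfI yN0); rewrite mulr1.
  by rewrite -[u]conjCK uc1 rmorph1.
have uE : y * (y * u^*)^* = u.
  by rewrite rmorphM /= conjCK mulrA -normCK y1 expr1n mul1r.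
apply: unit_circle_arg_eq => //.
- by rewrite normrM norm_conjC y1 u1 mulr1.
- by apply/eqP => E; move: yn; rewrite E expr1n => /eqP; rewrite -subr_eq0 opprK -mulr2n pnatr_eq0.
- rewrite uE; apply: le_trans le1; rewrite -Re_conj.
  suff -> : (y * u^* * y)^* = u * y^* ^+ 2 by [].
  by rewrite !rmorphM /= conjCK mulrC mulrA (mulrC _ u).
- by rewrite uE.
Qed.

Lemma expi2piE r :
  expi2pi r = ((`|denq r|%N).-root (-1) ^+ 2) ^ numq r.
Proof. by rewrite /expi2pi -exprz_exp. Qed.

Lemma expi2pi_primitive r : (`|denq r|%N).-primitive_root (expi2pi r).
Proof.
rewrite expi2piE; set n := `|denq r|%N; have n0 : (0 < n)%N by rewrite absz_gt0 denq_neq0.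
have := coprime_num_den r; rewrite -/n -(prim_root_exp_coprime _ (rootCN1_sqr_primitive n0)).
case: (numq r) => k // h; rewrite NegzE -exprnN.
suff -> : n.-primitive_root ((n.-root (-1) ^+ 2) ^- k.+1 : algC) =
          n.-primitive_root ((n.-root (-1) ^+ 2) ^+ k.+1 : algC) by [].
congr (_ && _); apply: eq_forallb => i.
by rewrite !unity_rootE exprVn invr_eq1.
Qed.

Lemma expi2pi_addz r (k : int) : expi2pi (r + k%:~R) = expi2pi r.
Proof.
have d0 := denq_neq0 r.
have cop : coprime `|numq r + k * denq r| `|denq r|.
  by rewrite -[coprime _ _]/(coprimez _ _) /coprimez gcdzC addrC gcdzMDl gcdzC; apply: coprime_num_den.
have E : r + k%:~R = (numq r + k * denq r)%:~R / (denq r)%:~R.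
  by rewrite intrD intrM mulrDl divq_num_den mulfK ?intr_eq0.
have Ed : denq (r + k%:~R) = denq r by rewrite E coprimeq_den // (negPf d0) normr_denq.
have En : numq (r + k%:~R) = numq r + k * denq r.
  by rewrite E coprimeq_num // gtr0_sg // mul1r.
rewrite !expi2piE Ed En; set z := _ ^+ 2.
have pz : (`|denq r|%N).-primitive_root z by apply: rootCN1_sqr_primitive; rewrite absz_gt0.
have uz : z \is a GRing.unit.
  by rewrite unitfE expf_neq0 // rootC_eq0 ?oppr_eq0 ?oner_eq0 // absz_gt0.
rewrite exprzDr // mulrC -[RHS]mul1r mulrC mulrC; congr (_ * _).
by rewrite mulrC -exprz_exp -absz_denq -exprnP (prim_expr_order pz) exp1rz.
Qed.

(** The order of the root of unity recovers the denominator; with a common denominator the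
    numerators are compared modulo it. *)
Lemma expi2pi_eq r1 r2 : (expi2pi r1 == expi2pi r2) = (r1 - r2 \is a Num.int).
Proof.
apply/eqP/idP => [E|/intrP[k Ek]]; last by rewrite -(expi2pi_addz r2 k) -Ek addrC subrK.
have p1 := expi2pi_primitive r1; have p2 := expi2pi_primitive r2.
have Ed : denq r1 = denq r2.
  rewrite -[denq r1]absz_denq -[denq r2]absz_denq; congr Posz; apply/eqP.
  rewrite eqn_dvd (prim_order_dvd p1) E (prim_expr_order p2) eqxx.
  by rewrite (prim_order_dvd p2) -E (prim_expr_order p1) eqxx.
move: E; rewrite !expi2piE Ed; set z := _ ^+ 2 => E.
have d0 := denq_neq0 r2.
have pz : (`|denq r2|%N).-primitive_root z by apply: rootCN1_sqr_primitive; rewrite absz_gt0.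
have uz : z \is a GRing.unit.
  by rewrite unitfE expf_neq0 // rootC_eq0 ?oppr_eq0 ?oner_eq0 // absz_gt0.
have Ez : z ^ (numq r1 - numq r2) = 1 by rewrite exprzDr // E -exprzDr // subrr expr0z.
have : (`|denq r2| %| `|numq r1 - numq r2|)%N.
  rewrite (prim_order_dvd pz); move: Ez; case: (_ - _) => k /=; first by move/eqP.
  rewrite NegzE -exprnN => /eqP; by rewrite invr_eq1.
rewrite -[dvdn _ _]/(dvdz _ _) => /dvdzP[k Ek].
apply/intrP; exists k; rewrite -{1}(divq_num_den r1) -{1}(divq_num_den r2) Ed.
by rewrite -mulrBl -intrB Ek intrM mulfK // intr_eq0.
Qed.

Lemma expi2pi_expr_eq1 r n : (expi2pi r ^+ n == 1) = (r * n%:R \is a Num.int).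
Proof.
rewrite -(prim_order_dvd (expi2pi_primitive r)); apply/idP/intrP => [|[k Ek]].
  rewrite -[X in (X %| _)%N]/(`|(denq r : int)|%N) => /dvdnP[k Ek]; exists (numq r * k%:Z).
  rewrite intrM numqE -mulrA; congr (_ * _).
  by rewrite -absz_denq -[k%:~R]/(k%:R) -[X in X * _]/(`|denq r|%N%:R) -natrM mulnC Ek.
have E : numq r * n%:Z = k * denq r.
  by apply: (@intr_inj rat); rewrite !intrM -Ek -[n%:~R]/(n%:R) numqE; ring.
have : (denq r %| numq r * n%:Z)%Z by rewrite E dvdz_mull.
by rewrite Gauss_dvdzr // /coprimez gcdzC; apply: coprime_num_den.
Qed.

(** * Power sums of the roots of a polynomial *)

(* [f' / f] expands as the sum of the [p_j X^(-j-1)], so [p_n] is the constant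
   term of the polynomial part of [X^(n+1) f' / f]. *)
Definition psum (K : fieldType) (n : nat) (f : {poly K}) : K :=
  (('X^(n.+1) * f^`()) %/ f)`_0.

(** Logarithmic derivatives add up, and so do their polynomial parts: the two remainders combine
    into one of degree less than that of [f * g]. *)
Lemma psumM (K : fieldType) n (f g : {poly K}) : f != 0 -> g != 0 ->
  psum n (f * g) = psum n f + psum n g.
Proof.
move=> f0 g0; have fg0 : f * g != 0 by rewrite mulf_neq0.
rewrite /psum -coefD.
set F := 'X^(n.+1) * f^`(); set G := 'X^(n.+1) * g^`().
have E : 'X^(n.+1) * (f * g)^`() = (F %/ f + G %/ g) * (f * g) + ((F %% f) * g + f * (G %% g)).
  rewrite derivM mulrDr !mulrA -/F [_ * f * g^`()]mulrAC -/G.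
  by rewrite {1}(divp_eq F f) {1}(divp_eq G g); ring.
rewrite -(divpP E) //.
rewrite (leq_ltn_trans (size_polyD _ _)) // gtn_max (size_mul f0 g0).
have h (a b : {poly K}) : b != 0 -> (size (a %% b)%R < size b)%N by rewrite ltn_modp.
move: (h F f f0) (h G g g0) (f0) (g0); rewrite -!size_poly_gt0 => h1 h2 h3 h4.
apply/andP; split; apply: (leq_ltn_trans (size_polyMleq _ _)).
  move: (size f) (size g) (size (F %% f)) h1 h2 h3 h4 => a b c h1 h2 h3 h4.
  by rewrite -!subn1; lia.
move: (size f) (size g) (size (G %% g)) h1 h2 h3 h4 => a b c h1 h2 h3 h4.
by rewrite -!subn1; lia.
Qed.

Lemma psum1 (K : fieldType) n : psum n (1 : {poly K}) = 0.
Proof. by rewrite /psum derivC mulr0 div0p coef0. Qed.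

(** The quotient is the geometric sum of the X^(n-i) a^i, whose constant term comes from i = n. *)
Lemma psum_XsubC (K : fieldType) n (a : K) : psum n ('X - a%:P) = a ^+ n.
Proof.
have E : 'X^(n.+1) = (\sum_(i < n.+1) 'X^(n - i) * a%:P ^+ i) * ('X - a%:P) + (a ^+ n.+1)%:P :> {poly K}.
  by apply/eqP; rewrite -subr_eq rmorphXn /= subrXX mulrC.
rewrite /psum derivXsubC mulr1 -(divpP E) ?size_XsubC; last first.
  by rewrite ltnS; apply: size_polyC_leq1.
rewrite coef_sum (bigD1 ord_max) //= big1 ?addr0; last first.
  move=> i ni; rewrite -rmorphXn coefMC coefXn /= eq_sym subn_eq0 leqNgt.
  by rewrite ltn_neqAle -ltnS ltn_ord -val_eqE /= in ni *; rewrite ni mul0r.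
by rewrite subnn expr0 mul1r -rmorphXn coefC.
Qed.

Lemma psum_prod_XsubC (K : fieldType) n (s : seq K) :
  psum n (\prod_(z <- s) ('X - z%:P)) = \sum_(z <- s) z ^+ n.
Proof.
elim: s => [|z s IH]; first by rewrite !big_nil psum1.
by rewrite !big_cons psumM ?polyXsubC_eq0 ?monic_neq0 ?monic_prod_XsubC // IH psum_XsubC.
Qed.

Lemma psum_map (K L : fieldType) (h : {rmorphism K -> L}) n f :
  psum n (map_poly h f) = h (psum n f).
Proof.
by rewrite /psum deriv_map -(map_polyXn h) -rmorphM -map_divp coef_map.
Qed.

(* The quotient of [X^(n+1) f'] by [f] has degree [n] and leading coefficient
   [n]; replacing [f] by [f + c] hence lowers it by the constant [n c]. *)
Lemma psum_addC (K : fieldType) n (f : {poly K}) c : (0 < n)%N ->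
  f \is monic -> size f = n.+1 -> psum n (f + c%:P) = psum n f - n%:R * c.
Proof.
case: n => // n _ fm sf; have f0 : f != 0 by rewrite monic_neq0.
have scf : (size (c%:P) < size f)%N by rewrite sf (leq_ltn_trans (size_polyC_leq1 _)).
have sfc : size (f + c%:P) = n.+2 by rewrite size_polyDl // sf.
rewrite /psum.
rewrite derivD derivC addr0; set G := 'X^(n.+2) * f^`().
set Q := G %/ f; set R := G %% f.
have sR : (size R <= n.+1)%N by rewrite -ltnS -sf ltn_modp.
have GE : G = Q * f + R by apply: divp_eq.
have sG : (size G <= n.+2 + n.+1)%N.
  apply: leq_trans (size_polyMleq _ _) _; rewrite size_polyXn /= leq_add2l.
  by rewrite -ltnS -sf lt_size_deriv.
have sQ : (size Q <= n.+2)%N by rewrite size_divp // sf /= leq_subLR (leq_trans sG) //; lia.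
have Qn : Q`_n.+1 = n.+1%:R.
  have : G`_(n.+2 + n) = n.+1%:R.
    rewrite coefXnM ltnNge leq_addr /= addKn coef_deriv.
    by move: fm; rewrite monicE lead_coefE sf /= => /eqP ->.
  rewrite GE coefD [R`_ _]nth_default ?addr0 => [<-|]; last by apply: leq_trans sR _; lia.
  rewrite coefM (bigD1 (inord n.+1)) //= big1 ?addr0.
    rewrite inordK; last by lia.
    have -> : (n.+2 + n - n.+1 = n.+1)%N by lia.
    by move: fm; rewrite monicE lead_coefE sf /= => /eqP ->; rewrite mulr1.
  move=> i ni; have [ilt|ige] := ltnP i n.+1.
    by rewrite [f`_ _]nth_default ?mulr0 // sf; lia.
  rewrite [Q`_ _]nth_default ?mul0r //; apply: leq_trans sQ _.
  rewrite ltn_neqAle ige andbT; apply: contra_neq ni => E.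
  by apply: val_inj; rewrite /= inordK // E; lia.
(* In the new remainder the coefficients of degree [n.+1] cancel: [- c *: Q] contributes
   [- c * n.+1%:R], and the last product contributes the opposite. *)
have E : G = (Q - (n.+1%:R * c)%:P) * (f + c%:P) +
     (R - c *: Q + (n.+1%:R * c)%:P * (f + c%:P)).
  by rewrite GE -mul_polyC; ring.
rewrite -(divpP E) ?coefB ?coefC //.
rewrite sfc ltnS; apply/leq_sizeP => j.
rewrite leq_eqVlt => /orP[/eqP <-|lt].
  rewrite coefD coefB coefZ coefCM coefD coefC /= Qn [R`_ _]nth_default //.
  have -> : f`_n.+1 = 1 by move: fm; rewrite monicE lead_coefE sf /= => /eqP.
  ring.
rewrite coefD coefB coefZ coefCM coefD coefC.
rewrite [R`_ _]nth_default ?[Q`_ _]nth_default ?[f`_ _]nth_default ?sf //;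
  try by [apply: leq_trans sQ lt | apply: leq_trans sR (ltnW lt)].
by case: j lt => // j _ /=; rewrite mulr0 subr0 add0r addr0 mulr0.
Qed.

(** * Frobenius orbits *)

Lemma dvdp_prod_XsubC_count (K : fieldType) (t s : seq K) :
  \prod_(z <- t) ('X - z%:P) %| \prod_(z <- s) ('X - z%:P) <->
  forall z, (count_mem z t <= count_mem z s)%N.
Proof.
split => [dv z|/count_subseqP[u us tu]].
  rewrite -(mu_prod_XsubC z s) mup_geq ?monic_neq0 ?monic_prod_XsubC //.
  apply: dvdp_trans dv.
  by rewrite -mup_geq ?monic_neq0 ?monic_prod_XsubC // mu_prod_XsubC.
rewrite (perm_big _ tu); have [m _ ->] := subseqP us.
elim: s m {us tu} => [|a s IH] [|[] m] /=; rewrite ?big_nil ?dvd1p //.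
  by rewrite !big_cons; apply: dvdp_mul => //; apply: IH.
by rewrite big_cons; apply: dvdp_mull; apply: IH.
Qed.

Lemma sum_dvdn_leq D m N : (0 < D)%N -> (D * m <= N)%N ->
  (\sum_(1 <= j < N.+1) ((D %| j)%N && (j %/ D <= m)%N) = m)%N.
Proof.
move=> D0 le; rewrite (@big_cat_nat _ _ _ (D * m).+1) //=.
rewrite [X in (_ + X)%N]big_nat_cond [X in (_ + X)%N]big1; last first.
  move=> j /andP[] /andP[lj _] _.
  case: (boolP (D %| j)%N) => //= /dvdnP[k Ek]; rewrite Ek mulnK //.
  by apply/eqP; rewrite eqb0 -ltnNge -(ltn_pmul2l D0) -(mulnC k) -Ek.
rewrite addn0.
transitivity (D * m %/ D)%N; last by rewrite mulKn.
rewrite (eq_big_nat _ _ (F2 := fun j => (D %| j)%N : nat)); last first.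
  move=> j /andP[_ lj]; case: (boolP (D %| j)%N) => //= /dvdnP[k Ek].
  by move: lj; rewrite ltnS Ek mulnK // mulnC leq_pmul2l // => ->.
elim: (D * m)%N => [|n IH]; first by rewrite div0n big_geq.
by rewrite big_nat_recr //= IH divnS // addnC.
Qed.

Section Frobenius.
Variables (F L : finFieldType) (iota : {rmorphism F -> L}).

(* The unused [iota] ties [frob] to an embedding of [F] in [L], without which
   it is not additive. *)
Definition frob (_ : {rmorphism F -> L}) (x : L) : L := x ^+ #|F|.

Local Notation phi := (frob iota).

Lemma card_pchar_nat : [pchar L].-nat #|F|.
Proof.
have [p pp pF] := finPcharP F.
have pg : p.-nat #|F|.
  rewrite -cardsT; exact: (@pprimeChar_pgroup p F pF).
apply: sub_in_pnat pg => r _ /eqP ->.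
by rewrite (rmorph_pchar iota pF).
Qed.

Fact frob_zmod_morphism : zmod_morphism phi.
Proof.
move=> x y; rewrite /frob exprDn_pchar ?card_pchar_nat // exprNn_pchar //.
exact: card_pchar_nat.
Qed.
Fact frob_monoid_morphism : monoid_morphism phi.
Proof. by split=> [|x y]; rewrite /frob ?expr1n ?exprMn. Qed.
HB.instance Definition _ := GRing.isZmodMorphism.Build L L phi frob_zmod_morphism.
HB.instance Definition _ := GRing.isMonoidMorphism.Build L L phi frob_monoid_morphism.

Lemma frob_inj : injective phi. Proof. exact: fmorph_inj. Qed.

Lemma frob_base a : phi (iota a) = iota a.
Proof. by rewrite /frob -rmorphXn expf_card. Qed.

(** A fixed point is a root of X^q - X, which already splits over [F]. *)
Lemma frob_fixed x : phi x = x -> exists a, x = iota a.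
Proof.
move=> fx; have : root (map_poly iota ('X^#|F| - 'X)) x.
  by rewrite rmorphB /= map_polyXn map_polyX rootE !hornerE -/(phi x) fx subrr.
rewrite finField_genPoly rmorph_prod /=.
rewrite (eq_bigr (fun z => 'X - (iota z)%:P)) => [|z _]; last first.
  by rewrite rmorphB /= map_polyX map_polyC.
rewrite rootE horner_prod => /prodf_eq0[a _]; rewrite hornerXsubC subr_eq0 => /eqP ->.
by exists a.
Qed.

Lemma frob_fixed_poly (g : {poly L}) : map_poly phi g = g ->
  exists f : {poly F}, map_poly iota f = g.
Proof.
move=> fg.
have h i : {a | g`_i == iota a}.
  by apply: sigW; have [|a ->] := @frob_fixed g`_i; [rewrite -coef_map fg|exists a].
exists (\poly_(i < size g) sval (h i)); apply/polyP => i.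
rewrite coef_map coef_poly; case: ltnP => [_|le]; first by case: (h i) => a /= /eqP.
by rewrite nth_default //= rmorph0.
Qed.

Lemma iter_frob j x : iter j phi x = x ^+ (#|F| ^ j).
Proof.
elim: j => [|j IH]; first by rewrite expn0 expr1.
by rewrite iterS IH /frob -exprM expnSr.
Qed.

(** For [y] fixed by [iter j phi] this is the characteristic polynomial of [y] over [F], with [y]
    seen in the extension of degree [j]: the minimal polynomial raised to the power [j] divided by
    the orbit length. *)
Definition frob_prod (j : nat) (y : L) : {poly L} :=
  \prod_(z <- traject phi y j) ('X - z%:P).

Lemma perm_traject_frob j y : iter j phi y = y ->
  perm_eq (map phi (traject phi y j)) (traject phi y j).
Proof.
move=> fy.
have -> : map phi (traject phi y j) = traject phi (phi y) j.
  by elim: j {fy} y => //= j IH y; rewrite IH.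
rewrite -(perm_cons y).
by rewrite -[y :: _]/(traject phi y j.+1) trajectSr fy perm_rcons.
Qed.

Lemma frob_prod_base j y : iter j phi y = y ->
  exists f : {poly F}, map_poly iota f = frob_prod j y.
Proof.
move=> fy; apply: frob_fixed_poly; rewrite rmorph_prod /=.
rewrite (eq_bigr (fun z => 'X - (phi z)%:P)) => [|z _]; last first.
  by rewrite rmorphB /= map_polyX map_polyC.
rewrite -(big_map phi xpredT (fun z => 'X - z%:P)); apply: perm_big.
exact: perm_traject_frob.
Qed.

Lemma iter_frob_order j y : (iter j phi y == y) = (fingraph.order phi y %| j)%N.
Proof.
have it k : iter (k * fingraph.order phi y) phi y = y.
  by elim: k => // k IH; rewrite mulSn iterD IH iter_order //; apply: frob_inj.
rewrite {1}(divn_eq j (fingraph.order phi y)) addnC iterD it.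
have lt : (j %% fingraph.order phi y < fingraph.order phi y)%N by rewrite ltn_mod fingraph.order_gt0.
apply/eqP/idP => [E|/eqP ->] //.
by have := findex_iter lt; rewrite E findex0 /dvdn => <-.
Qed.

Lemma count_traject_frob e y z :
  count_mem z (traject phi y (fingraph.order phi y * e)) = (e * (z \in fingraph.orbit phi y))%N.
Proof.
elim: e => [|e IH]; first by rewrite muln0.
rewrite mulnS trajectD count_cat iter_order ?IH; last exact: frob_inj.
by rewrite -/(fingraph.orbit phi y) count_uniq_mem ?fingraph.orbit_uniq // mulSn.
Qed.

(** Let [y] have orbit length D and multiplicity m in [s]. Among the powers of its minimal
    polynomial exactly the first m divide [f], so [y] is counted for j = D, 2D, ..., mD, that is m
    times. Summing the multiplicities gives the degree of [f]. *)
Lemma sum_frob_prod_dvdp (f : {poly F}) (s : seq L) :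
  map_poly iota f = \prod_(z <- s) ('X - z%:P) ->
  (\sum_(1 <= j < (size s).+1)
     #|[set y | (iter j phi y == y) && (frob_prod j y %| map_poly iota f)%R]|
   = size s)%N.
Proof.
move=> Ef.
(* Multiplicities are constant on Frobenius orbits because [f] has its coefficients in [F]. *)
have inv y : count_mem (phi y) s = count_mem y s.
  have : perm_eq (map phi s) s.
    apply: prod_XsubC_eq; rewrite -Ef big_map.
    transitivity (map_poly phi (map_poly iota f)).
      rewrite Ef rmorph_prod /=; apply: eq_bigr => z _.
      by rewrite rmorphB /= map_polyX map_polyC.
    by rewrite -map_poly_comp; apply: eq_map_poly => a /=; apply: frob_base.
  move=> /seq.permP /(_ (pred1 (phi y))) <-; rewrite count_map; apply: eq_count => z /=.
  by rewrite (inj_eq frob_inj).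
have inv_orbit y z : z \in fingraph.orbit phi y -> count_mem z s = count_mem y s.
  by move=> /trajectP[i _ ->]; elim: i => //= i IH; rewrite inv.
have dv y e : (frob_prod (fingraph.order phi y * e) y %| map_poly iota f) = (e <= count_mem y s)%N.
  rewrite Ef; apply/idP/idP => [/dvdp_prod_XsubC_count/(_ y)|le].
    by rewrite count_traject_frob in_orbit muln1.
  apply/dvdp_prod_XsubC_count => z; rewrite count_traject_frob.
  by case: (boolP (z \in _)) => [/inv_orbit ->|_]; rewrite ?muln1 ?muln0.
transitivity (\sum_(y : L) count_mem y s)%N; last first.
  rewrite -sum1_size; elim: s {Ef inv inv_orbit dv} => [|a s IH].
    by rewrite big_nil big1.
  rewrite big_cons -IH /= big_split /= (bigD1 a) //= eqxx big1 // => y.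
  by rewrite eq_sym => /negPf ->.
rewrite (eq_bigr (fun j => \sum_(y : L) ((iter j phi y == y) && (frob_prod j y %| map_poly iota f)%R : nat)))%N; last first.
  move=> j _; rewrite -sum1_card big_mkcond /=; apply: eq_bigr => y _.
  by rewrite inE; case: ifP.
rewrite exchange_big /=; apply: eq_bigr => y _.
rewrite -[RHS](@sum_dvdn_leq (fingraph.order phi y) _ (size s)) ?fingraph.order_gt0 //; last first.
  have := dv y (count_mem y s); rewrite leqnn Ef.
  move=> /dvdp_leq; rewrite monic_neq0 ?monic_prod_XsubC // => /(_ isT).
  by rewrite !size_prod_XsubC ltnS size_traject.
apply: eq_bigr => j _; rewrite iter_frob_order; case: (boolP (_ %| j)%N) => //= /dvdnP[e ->].
by rewrite mulnK ?fingraph.order_gt0 // mulnC dv.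
Qed.

End Frobenius.

(** * Sums of multiplicative functions over monic polynomials *)

(** A splitting field of the product of the finitely many nonzero polynomials of size at most [N]. A
    single [L] thus serves all degrees that occur in the recursions below. *)
Lemma finField_split_ext (F : finFieldType) (N : nat) :
  exists (L : finFieldType) (iota : {rmorphism F -> L}),
  forall f : {poly F}, f \is monic -> (size f <= N)%N ->
  exists s : seq L, map_poly iota f = \prod_(z <- s) ('X - z%:P).
Proof.
pose p : {poly F} := \prod_(f : {poly_N F} | (f : {poly F}) != 0) (f : {poly F}).
have p0 : p != 0 by apply/prodf_neq0.
have [L [zs Dp _]] := FinSplittingFieldFor p0.
have h (f : {poly F}) : f \is monic -> (size f <= N)%N ->
    exists s : seq L, map_poly (GRing.in_alg L) f = \prod_(z <- s) ('X - z%:P).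
  move=> fm sf; have : map_poly (GRing.in_alg L) f %| map_poly (GRing.in_alg L) p.
    rewrite dvdp_map /p (bigD1 (npolyp N f)) /= ?npolypK ?monic_neq0 //.
    exact: dvdp_mulr.
  rewrite (eqp_dvdr _ Dp) => /dvdp_prod_XsubC[m Em].
  by exists (mask m zs); apply/eqP; rewrite -eqp_monic ?monic_prod_XsubC ?monic_map //.
exists (FinFieldExtType L).
exists (GRing.in_alg L).
exact: h.
Qed.

Lemma size_monic_subXn (R : nzRingType) (f : {poly R}) d : f \is monic -> size f = d.+1 ->
  (size (f - 'X^d)%R <= d)%N.
Proof.
move=> fm sf; apply/leq_sizeP => j; rewrite leq_eqVlt coefB coefXn => /orP[/eqP <-|lt].
  by rewrite eqxx; move: fm; rewrite monicE lead_coefE sf /= => /eqP ->; rewrite subrr.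
by rewrite nth_default ?sf // gtn_eqF // subrr.
Qed.

Lemma monic_Xn_add (R : nzRingType) (d : nat) (r : {poly_d R}) :
  ('X^d + (r : {poly R}) \is monic) /\ (size ('X^d + (r : {poly R}))%R = d.+1).
Proof.
have lt : (size (r : {poly R}) < size ('X^d : {poly R}))%N.
  by rewrite size_polyXn ltnS size_npoly.
by rewrite monicE lead_coefDl // lead_coefXn eqxx size_polyDl // size_polyXn.
Qed.

Section MonicSums.
Variables (F : finFieldType) (Lam : {poly F} -> algC).
Hypothesis LamM : forall f g, f \is monic -> g \is monic -> Lam (f * g) = Lam f * Lam g.

(** The coefficient of T^d in the L-function of [Lam]: a monic polynomial of degree [d] is X^d + r
    for a unique r of size at most [d]. *)
Definition monic_sum (d : nat) : algC := \sum_(r : {poly_d F}) Lam ('X^d + (r : {poly F})).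

(** Multiplication by [c] is a bijection from the monic polynomials of degree [d - j] onto the monic
    multiples of [c] of degree [d]; [to] and [from] express it on the lower order parts. *)
Lemma monic_sum_dvdp (c : {poly F}) j d : c \is monic -> size c = j.+1 -> (j <= d)%N ->
  \sum_(r : {poly_d F} | c %| 'X^d + (r : {poly F})) Lam ('X^d + (r : {poly F})) =
  Lam c * monic_sum (d - j).
Proof.
move=> cm sc jd; have c0 := monic_neq0 cm.
pose to (h : {poly_(d - j) F}) := npolyp d (c * ('X^(d - j) + (h : {poly F})) - 'X^d).
pose from (r : {poly_d F}) := npolyp (d - j) (('X^d + (r : {poly F})) %/ c - 'X^(d - j)).
have toE h : 'X^d + (to h : {poly F}) = c * ('X^(d - j) + (h : {poly F})).
  have [hm hs] := monic_Xn_add h.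
  rewrite /to npolypK; first by rewrite addrC subrK.
  apply: size_monic_subXn; first by rewrite monicMl.
  by rewrite size_mul ?monic_neq0 // sc hs addSn /= addnS subnKC.
have fromE (r : {poly_d F}) : c %| 'X^d + (r : {poly F}) ->
    c * ('X^(d - j) + (from r : {poly F})) = 'X^d + (r : {poly F}).
  move=> dv; have [rm rs] := monic_Xn_add r.
  rewrite /from npolypK; first by rewrite addrC subrK mulrC divpK.
  apply: size_monic_subXn; last by rewrite size_divp // rs sc /= subSn.
  by rewrite -(monicMr _ cm) divpK.
rewrite (reindex_onto to from) => [|r dv]; last first.
  by apply/val_inj; apply: (addrI 'X^d); rewrite toE fromE.
rewrite /monic_sum mulr_sumr; apply: eq_big => [h|h _].
  rewrite toE dvdp_mulr //=; apply/eqP/val_inj.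
  have := toE h; set r := to h => Er; apply: (addrI 'X^(d - j)); apply: (mulfI c0).
  by rewrite fromE Er // dvdp_mulr.
by rewrite toE LamM //; have [] := monic_Xn_add h.
Qed.

Variables (L : finFieldType) (iota : {rmorphism F -> L}) (B : nat -> L -> algC).
Local Notation phi := (frob iota).

Hypothesis LamB : forall j y f, iter j phi y = y -> map_poly iota f = frob_prod iota j y ->
  Lam f = B j y.

Definition frob_sum (j : nat) : algC := \sum_(y : L | iter j phi y == y) B j y.

(* Coefficient form of T A'(T) = B(T) A(T), where A is the generating series
   of the [monic_sum]s: the logarithmic derivative of an Euler product. *)
Lemma monic_sum_rec d :
  (forall f : {poly F}, f \is monic -> (size f <= d.+1)%N ->
    exists s : seq L, map_poly iota f = \prod_(z <- s) ('X - z%:P)) ->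
  d%:R * monic_sum d = \sum_(1 <= j < d.+1) frob_sum j * monic_sum (d - j).
Proof.
move=> splitL; rewrite /monic_sum mulr_sumr.
(* The factor [d] is written as the number of pairs (j, y) counted by [sum_frob_prod_dvdp]. After
   exchanging the sums, each pair leaves a sum over the multiples of one polynomial. *)
transitivity (\sum_(r : {poly_d F}) \sum_(1 <= j < d.+1)
  \sum_(y : L | (iter j phi y == y) && (frob_prod iota j y %| map_poly iota ('X^d + (r : {poly F}))))
    Lam ('X^d + (r : {poly F}))).
  apply: eq_bigr => r _; have [rm rs] := monic_Xn_add r.
  have [|s Es] := splitL _ rm; first by rewrite rs.
  have ds : d = size s.
    by apply: succn_inj; rewrite -rs -(size_map_poly iota) Es size_prod_XsubC.
  rewrite {1}ds -(sum_frob_prod_dvdp Es) -ds natr_sum mulr_suml; apply: eq_bigr => j _.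
  by rewrite -sumr_const mulr_suml; apply: eq_big => y; rewrite ?inE // mul1r.
rewrite exchange_big /=; apply: eq_big_nat => j /andP[_ jd].
rewrite /frob_sum mulr_suml.
rewrite (exchange_big_dep (fun y => iter j phi y == y)) /=; last by move=> r y _ /andP[].
apply: eq_bigr => y /eqP fy; have [c Ec] := frob_prod_base fy.
have sc : size c = j.+1 by rewrite -(size_map_poly iota) Ec size_prod_XsubC size_traject.
have cm : c \is monic by rewrite -(map_monic iota) Ec monic_prod_XsubC.
rewrite -(LamB fy Ec) -(monic_sum_dvdp cm sc) //; apply: eq_bigl => r.
by rewrite fy eqxx -Ec dvdp_map.
Qed.

End MonicSums.

(** * Newton's recursion for the coefficients of a generating series *)

Section NewtonRecursion.
Variable K : numFieldType.

Definition newton_rec (n : nat) (b a : nat -> K) :=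
  forall d, (d <= n)%N -> d%:R * a d = \sum_(1 <= j < d.+1) b j * a (d - j)%N.

(** In characteristic 0 one can divide by [d], so each coefficient is determined by the previous
    ones. *)
Lemma newton_rec_unique n b a a' : a 0%N = a' 0%N ->
  newton_rec n b a -> newton_rec n b a' -> forall d, (d <= n)%N -> a d = a' d.
Proof.
move=> a0 ra ra'; elim/ltn_ind => -[|d] IH dn //.
have d0 : d.+1%:R != 0 :> K by rewrite pnatr_eq0.
apply: (mulfI d0); rewrite ra // ra' //; apply: eq_big_nat => j /andP[j0 jd].
by rewrite IH //; lia.
Qed.

(** The polynomial form T A' = B A modulo T^(n+1), in which solutions can be multiplied. The
    constant term of B is set to 0 because the recursion starts at j = 1. *)
Lemma newton_recP n b (A : {poly K}) :
  newton_rec n b (fun d => A`_d) <->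
  forall d, (d <= n)%N ->
    ('X * A^`() - (\poly_(j < n.+1) (if j == 0 then 0 else b j)) * A)`_d = 0.
Proof.
have E d : (d <= n)%N ->
  ('X * A^`() - (\poly_(j < n.+1) (if j == 0 then 0 else b j)) * A)`_d =
  d%:R * A`_d - \sum_(1 <= j < d.+1) b j * A`_(d - j).
  move=> dn; rewrite coefB coefXM coef_deriv coefM; congr (_ - _).
    by case: d dn => [|d] _; rewrite ?mul0r //= mulr_natl.
  rewrite -(big_mkord xpredT (fun j =>
    (\poly_(j < n.+1) (if j == 0 then 0 else b j))`_j * A`_(d - j))).
  rewrite big_ltn // coef_poly /= mul0r add0r; apply: eq_big_nat => j /andP[j0 jd].
  by rewrite coef_poly (leq_trans jd) // gtn_eqF.
split => h d dn; first by rewrite E // h // subrr.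
by apply/eqP; rewrite -subr_eq0 -E // h.
Qed.

(** Leibniz rule: the logarithmic derivative of a product is the sum of those of its factors. *)
Lemma newton_recM n b b' (A A' : {poly K}) :
  newton_rec n b (fun d => A`_d) -> newton_rec n b' (fun d => A'`_d) ->
  newton_rec n (fun j => b j + b' j) (fun d => (A * A')`_d).
Proof.
move=> /newton_recP h /newton_recP h'; apply/newton_recP => d dn.
set B := \poly_(j < n.+1) (if j == 0 then 0 else b j) in h.
set B' := \poly_(j < n.+1) (if j == 0 then 0 else b' j) in h'.
have -> : \poly_(j < n.+1) (if j == 0 then 0 else b j + b' j) = B + B'.
  apply/polyP => j; rewrite coefD !coef_poly; case: ifP => _; last by rewrite addr0.
  by case: eqP => _; rewrite ?addr0.
have -> : 'X * (A * A')^`() - (B + B') * (A * A') =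
  ('X * A^`() - B * A) * A' + A * ('X * A'^`() - B' * A').
  by rewrite derivM; ring.
rewrite coefD !coefM !big1 ?addr0 // => i _.
  by rewrite h' ?mulr0 //; lia.
by rewrite h ?mul0r // (leq_trans _ dn) // -ltnS.
Qed.

Lemma newton_rec_prod n (I : finType) (b : I -> nat -> K) (A : I -> {poly K}) :
  (forall i, newton_rec n (b i) (fun d => (A i)`_d)) ->
  newton_rec n (fun j => \sum_i b i j) (fun d => (\prod_i A i)`_d).
Proof.
move=> h.
have rec0 : newton_rec n (fun=> 0) (fun d => (1 : {poly K})`_d).
  move=> d _; rewrite coef1 big1 => [|j _]; last by rewrite mul0r.
  by case: d => [|d]; rewrite ?mul0r ?mulr0.
suff : forall s : seq I,
  newton_rec n (fun j => \sum_(i <- s) b i j) (fun d => (\prod_(i <- s) A i)`_d) by apply.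
elim=> [|i s IH] d dn.
  by rewrite big_nil rec0 //; apply: eq_bigr => j _; rewrite big_nil.
rewrite big_cons (newton_recM (h i) IH) //; apply: eq_bigr => j _.
by rewrite big_cons.
Qed.

End NewtonRecursion.

(** * Characters and Gauss sums of a finite field *)

(** Vieta's formula, obtained without splitting [f]: the quotient of X^2 f' by f is (d+1) X -
    f_d. *)
Lemma psum_one (K : fieldType) (f : {poly K}) d : f \is monic -> size f = d.+2 ->
  psum 1 f = - f`_d.
Proof.
move=> fm sf; have f1 : f`_d.+1 = 1 by move: fm; rewrite monicE lead_coefE sf => /eqP.
have E : 'X^2 * f^`() = ((d.+1%:R)%:P * 'X - (f`_d)%:P) * f +
   ('X^2 * f^`() - ((d.+1%:R)%:P * 'X - (f`_d)%:P) * f) by rewrite addrC subrK.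
rewrite /psum -(divpP E); last first.
  rewrite sf ltnS; apply/leq_sizeP => j lj.
  have cf2 k : (d.+1 < k)%N -> f`_k = 0 by move=> lk; rewrite nth_default ?sf.
  rewrite coefB coefXnM coef_deriv mulrBl coefB -mulrA !coefCM coefXM.
  move: lj; rewrite leq_eqVlt => /orP[/eqP <-|lj].
    case: d f1 {sf cf2 E} => [|d] f1; first by rewrite /= f1; ring.
    by rewrite (_ : (d.+2 < 2)%N = false) // !subSS subn0 /= f1 -(mulr_natl _ d.+1) (mulrSr 1 d.+1); ring.
  case: j lj => [|[|j]] // lj; rewrite (_ : (j.+2 < 2)%N = false) // !subSS subn0 (cf2 _ lj) /=.
  move: lj; rewrite ltnS leq_eqVlt => /orP[/eqP [<-]|lj]; first by rewrite f1; ring.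
  by rewrite cf2 //; ring.
by rewrite coefB coefMX eqxx coefC /= sub0r.
Qed.

Section PrimitiveFF.
Variable F : finFieldType.

Lemma expf_card_pred (x : F) : x != 0 -> x ^+ #|F|.-1 = 1.
Proof.
move=> x0; apply: (mulfI x0); rewrite -exprS prednK; last by apply/card_gt0P; exists x.
by rewrite expf_card mulr1.
Qed.

Lemma card_finField_pred_gt0 : (0 < #|F|.-1)%N.
Proof. by rewrite -ltnS prednK ?finNzRing_gt1 // ltnW ?finNzRing_gt1. Qed.

Lemma finField_prim_root : exists w : F, (#|F|.-1).-primitive_root w.
Proof.
have h : has (#|F|.-1).-primitive_root [seq x : F <- enum F | x != 0].
  apply: has_prim_root; first exact: card_finField_pred_gt0.
  - by apply/allP => x; rewrite mem_filter unity_rootE => /andP[x0 _]; rewrite expf_card_pred.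
  - by rewrite filter_uniq ?enum_uniq.
  - rewrite -(cardC1 (0 : F)) cardE uniq_leq_size ?enum_uniq // => x.
    by rewrite mem_enum mem_filter mem_enum inE => /= ->.
by have /hasP[w _ pw] := h; exists w.
Qed.

Lemma natr_card_finField : #|F|%:R = 0 :> F.
Proof.
have [p pp pF] := finPcharP F.
have pg : p.-nat #|F| by rewrite -cardsT; exact: (@pprimeChar_pgroup p F pF).
apply/eqP; rewrite -(dvdn_pcharf pF).
have /p_natP[k Ek] := pg; rewrite Ek.
case: k Ek => [|k] Ek; last by rewrite expnS dvdn_mulr.
by have := finNzRing_gt1 F; rewrite Ek.
Qed.

(** In [F] the integer q - 1 equals -1, so its divisors are invertible. *)
Lemma natr_dvd_card_neq0 n : (n %| #|F|.-1)%N -> n%:R != 0 :> F.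
Proof.
move=> /dvdnP[k Ek]; apply/eqP => n0.
have := natr_card_finField; rewrite -(@prednK #|F|) ?(ltnW (finNzRing_gt1 F)) //.
by rewrite Ek -addn1 natrD natrM n0 mulr0 add0r => /eqP; rewrite oner_eq0.
Qed.
End PrimitiveFF.

Lemma card_unity_roots (L : finFieldType) n (z : L) : n.-primitive_root z ->
  #|[set u : L | u ^+ n == 1]| = n.
Proof.
move=> pz; rewrite -[RHS]card_ord -(card_imset predT (f := fun i : 'I_n => z ^+ i)); last first.
  move=> i j /eqP; rewrite (eq_prim_root_expr pz) !modn_small // => /eqP E.
  exact: val_inj.
apply: eq_card => u; rewrite inE; apply/eqP/imsetP => [/(prim_rootP pz)[i ->]|[i _ ->]].
  by exists i.
by rewrite -exprM mulnC exprM (prim_expr_order pz) expr1n.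
Qed.

Section Characters.
Variables (F : finFieldType) (psi omega : F -> algC).
Hypothesis psiP : is_add_char psi.
Hypothesis psiN : exists x, psi x != 1.
Hypothesis omegaP : generates_char_group omega.

Lemma psiD x y : psi (x + y) = psi x * psi y. Proof. by case: psiP => h _; apply: h. Qed.
Lemma psi_neq0 x : psi x != 0. Proof. by case: psiP => _; apply. Qed.
Lemma psi0 : psi 0 = 1.
Proof. by apply: (mulfI (psi_neq0 0)); rewrite -psiD addr0 mulr1. Qed.

Lemma sum_psi (c : F) : c != 0 -> \sum_x psi (c * x) = 0.
Proof.
move=> c0; have [a pa] := psiN; apply: (mulIf (x := psi a - 1)); first by rewrite subr_eq0.
rewrite mul0r mulrBr mulr1 mulr_suml; apply/eqP; rewrite subr_eq0; apply/eqP.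
rewrite [RHS](reindex_inj (addIr (a / c))); apply: eq_bigr => x _.
by rewrite mulrDr mulrCA divff // mulr1 psiD.
Qed.

Lemma omegaM x y : x != 0 -> y != 0 -> omega (x * y) = omega x * omega y.
Proof. by case: omegaP => -[h _] _; apply: h. Qed.
Lemma omega_neq0 x : x != 0 -> omega x != 0. Proof. by case: omegaP => -[_ h] _; apply: h. Qed.
Lemma omega_unit x : x != 0 -> omega x \is a GRing.unit.
Proof. by move=> x0; rewrite unitfE omega_neq0. Qed.
Lemma omega1 : omega 1 = 1.
Proof. by apply: (mulfI (omega_neq0 (oner_neq0 F))); rewrite -omegaM ?oner_neq0 // !mulr1. Qed.
Lemma omegaX x n : x != 0 -> omega (x ^+ n) = omega x ^+ n.
Proof.
by move=> x0; elim: n => [|n IH]; rewrite ?omega1 // !exprS omegaM ?expf_neq0 // IH.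
Qed.
Lemma omega_card x : x != 0 -> omega x ^+ #|F|.-1 = 1.
Proof. by move=> x0; rewrite -omegaX // expf_card_pred // omega1. Qed.

(** A generator of the character group is faithful: the character sending a generator [w] of the
    unit group to a primitive root of unity [z] is faithful, and it is a power of [omega]. Here [lg]
    is the discrete logarithm to base [w]. *)
Lemma omega_inj1 x : x != 0 -> omega x = 1 -> x = 1.
Proof.
move=> x0 ox; have [w pw] := finField_prim_root F.
have [z pz] := C_prim_root_exists (card_finField_pred_gt0 F).
pose lg (y : F) : nat := if [pick i : 'I_(#|F|.-1) | y == w ^+ i] is Some i then i else 0%N.
have lgK y : y != 0 -> y = w ^+ lg y.
  move=> y0; have [i Ei] := prim_rootP pw (expf_card_pred y0).
  by rewrite /lg; case: pickP => [k /eqP //|/(_ i)]; rewrite Ei eqxx.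
have chiP : is_mult_char (fun y => z ^+ lg y).
  split=> [a b a0 b0|a _].
    rewrite -exprD; apply/eqP; rewrite (eq_prim_root_expr pz) -(eq_prim_root_expr pw).
    by rewrite exprD -!lgK ?mulf_neq0.
  rewrite expf_neq0 //; apply/eqP => z0; have := prim_expr_order pz.
  by rewrite z0 expr0n gtn_eqF ?card_finField_pred_gt0 // => /esym/eqP; rewrite oner_eq0.
case: omegaP => _ /(_ _ chiP)[k /(_ x x0)]; rewrite ox expr1n => /eqP.
rewrite -(prim_order_dvd pz) => /dvdnP[m Em].
by rewrite (lgK x x0) Em mulnC exprM (prim_expr_order pw) expr1n.
Qed.

(** The value at 0 is 0 for the trivial character too, in accordance with the range of summation in
    [gauss]. *)
Definition mchar (m : int) (x : F) : algC := if x == 0 then 0 else omega x ^ m.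

Lemma mcharE m x : x != 0 -> mchar m x = omega x ^ m.
Proof. by rewrite /mchar => /negPf ->. Qed.

Lemma mcharM m x y : mchar m (x * y) = mchar m x * mchar m y.
Proof.
have [->|x0] := eqVneq x 0; first by rewrite mul0r /mchar eqxx mul0r.
have [->|y0] := eqVneq y 0; first by rewrite mulr0 /mchar eqxx mulr0.
by rewrite !mcharE ?mulf_neq0 // omegaM // exprzMl ?omega_unit.
Qed.

Lemma mchar1 m : mchar m 1 = 1.
Proof. by rewrite mcharE ?oner_neq0 // omega1 exp1rz. Qed.

Lemma gaussE m : gauss psi omega m = \sum_x mchar m x * psi x.
Proof.
rewrite /gauss big_mkcond; apply: eq_bigr => x _.
by rewrite /mchar; case: eqP => //= _; rewrite mul0r.
Qed.

Lemma gauss0 : gauss psi omega 0 = -1.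
Proof.
have := sum_psi (oner_neq0 F); rewrite (bigD1 0) //= mul1r psi0 => /eqP.
rewrite addrC addr_eq0 => /eqP <-; apply: eq_bigr => x _.
by rewrite expr0z !mul1r.
Qed.

Lemma omega_periodic x m (k : int) : x != 0 ->
  omega x ^ (m + k * (#|F|.-1)%:Z) = omega x ^ m.
Proof.
move=> x0; rewrite exprzDr ?omega_unit // (mulrC k) -exprz_exp -exprnP omega_card //.
by rewrite exp1rz mulr1.
Qed.

Lemma gauss_periodic m (k : int) :
  gauss psi omega (m + k * (#|F|.-1)%:Z) = gauss psi omega m.
Proof. by apply: eq_bigr => x x0; rewrite omega_periodic. Qed.

End Characters.

(** * The Hasse-Davenport product formula *)

Lemma sum_exp_unity (n : nat) (z : algC) : z ^+ n = 1 ->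
  \sum_(k < n) z ^+ k = if z == 1 then n%:R else 0.
Proof.
move=> zn; have [->|z1] := eqVneq z 1.
  by rewrite (eq_bigr (fun=> 1)) ?sumr_const ?card_ord // => k _; rewrite expr1n.
by have /eqP := subrX1 z n; rewrite zn subrr eq_sym mulf_eq0 subr_eq0 (negPf z1) /= => /eqP.
Qed.

Lemma coef_prod_1addCX (K : comNzRingType) n (c : 'I_n -> K) :
  (\prod_(k < n) (1 + (c k)%:P * 'X))`_n = \prod_(k < n) c k.
Proof.
suff h : (size (\prod_(k < n) (1 + (c k)%:P * 'X))%R <= n.+1)%N /\
  (\prod_(k < n) (1 + (c k)%:P * 'X))`_n = \prod_(k < n) c k by case: h.
elim: n c => [|n IH] c; first by rewrite !big_ord0 size_poly1 coef1.
have [sz co] := IH (fun k => c (widen_ord (leqnSn n) k)).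
rewrite !big_ord_recr /= -co; split.
  rewrite (leq_trans (size_polyMleq _ _)) //.
  have h : (size (1 + (c ord_max)%:P * 'X)%R <= 2)%N.
    rewrite (leq_trans (size_polyD _ _)) // geq_max size_poly1 /= mul_polyC.
    by rewrite (leq_trans (size_scale_leq _ _)) // size_polyX.
  by rewrite -subn1 leq_subLR (leq_trans (leq_add sz h)) // addn2 add1n.
rewrite mulrDr mulr1 coefD nth_default // add0r mulrA coefMX /= coefMC //.
Qed.

(** * Counting n-th roots in extensions of a finite field *)

Section NthRoots.
Variables (F L : finFieldType) (iota : {rmorphism F -> L}).
Local Notation phi := (frob iota).
Local Notation q1 := (#|F|.-1).

(* An n-th root exists in [L] because [X^n - x] divides [X^(q^j) - X], which splits. *)
Lemma card_nth_root_fixed n j (x : L) : (0 < n)%N -> (n %| q1)%N ->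
  (exists s : seq L, map_poly iota ('X^(#|F| ^ j) - 'X) = \prod_(z <- s) ('X - z%:P)) ->
  x != 0 -> iter j phi x = x ->
  #|[set y : L | (iter j phi y == y) && (y ^+ n == x)]| =
  if x ^+ ((#|F| ^ j).-1 %/ n) == 1 then n else 0%N.
Proof.
move=> n0 nq [s Es] x0 fx.
have q0 : (0 < #|F|)%N by rewrite ltnW ?finNzRing_gt1.
have Q0 : (0 < #|F| ^ j)%N by rewrite expn_gt0 q0.
have nQ : (n %| (#|F| ^ j).-1)%N by apply: dvdn_trans nq _; rewrite dvdn_pred_predX.
set M := ((#|F| ^ j).-1 %/ n)%N; have EM : (M * n = (#|F| ^ j).-1)%N by rewrite divnK.
have fixE (y : L) : y != 0 -> (iter j phi y == y) = (y ^+ (#|F| ^ j).-1 == 1).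
  by move=> y0; rewrite iter_frob -[RHS](inj_eq (mulfI y0)) -exprS prednK // mulr1.
have [xM|xM] := eqVneq (x ^+ M) 1; last first.
  apply/eqP; rewrite cards_eq0; apply/eqP/setP => y; rewrite !inE; apply/negP => /andP[fy /eqP yx].
  have y0 : y != 0 by apply: contraNneq x0 => y0; rewrite -yx y0 expr0n gtn_eqF.
  by move/eqP: xM; apply; rewrite -yx -exprM mulnC EM; apply/eqP; rewrite -fixE.
have [y0 Ey0] : exists y0, y0 ^+ n = x.
  have dv : 'X^n - x%:P %| \prod_(z <- s) ('X - z%:P).
    rewrite -Es rmorphB /= map_polyXn map_polyX.
    have -> : 'X^(#|F| ^ j) - 'X = (('X^n) ^+ M - (x%:P) ^+ M) * 'X :> {poly L}.
      by rewrite -rmorphXn /= xM mulrBl mul1r -exprM mulnC EM -exprSr prednK.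
    by rewrite subrXX -mulrA dvdp_mulr.
  have [m Em] := dvdp_prod_XsubC dv.
  have := eqp_size Em; rewrite size_prod_XsubC size_XnsubC //.
  case Ems : (mask m s) => [|y t]; first by move=> [E]; rewrite E in n0.
  move=> _; exists y; have : root ('X^n - x%:P) y.
    by rewrite (eqp_root Em) Ems root_prod_XsubC inE eqxx.
  by rewrite rootE !hornerE subr_eq0 => /eqP.
have y00 : y0 != 0 by apply: contraNneq x0 => E; rewrite -Ey0 E expr0n gtn_eqF.
have [w pw] := finField_prim_root F.
have pz := dvdn_prim_root pw nq.
(* As [n] divides q - 1, the n-th roots of unity come from [F]; multiplying [y0] by them gives all
   n-th roots of [x]. *)
have pz' : n.-primitive_root (iota (w ^+ (q1 %/ n))) by rewrite fmorph_primitive_root.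
rewrite -[RHS](card_unity_roots pz') -[RHS](card_imset _ (mulfI y00)).
apply: eq_card => y; apply/idP/imsetP => [|[u]].
  rewrite inE => /andP[fy /eqP yx].
  exists (y0^-1 * y); last by rewrite mulVKf.
  by rewrite inE exprMn exprVn Ey0 yx mulVf.
rewrite inE => /eqP un ->.
have yx : (y0 * u) ^+ n = x by rewrite exprMn Ey0 un mulr1.
rewrite inE yx eqxx andbT.
have yu0 : y0 * u != 0 by apply: contraNneq x0 => E; rewrite -yx E expr0n gtn_eqF.
by rewrite fixE // -EM mulnC exprM yx xM.
Qed.
End NthRoots.

Section HasseDavenport.
Variables (F : finFieldType) (psi omega : F -> algC).
Hypothesis psiP : is_add_char psi.
Hypothesis psiN : exists x, psi x != 1.
Hypothesis omegaP : generates_char_group omega.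
Local Notation mchar := (mchar omega).
Local Notation g := (gauss psi omega).
Local Notation q1 := (#|F|.-1).

Definition poly_char (m : int) (n : nat) (f : {poly F}) : algC :=
  mchar m ((-1) ^+ (size f).-1 * f`_0) * psi (psum n f).

Lemma poly_charM m n f h : f \is monic -> h \is monic ->
  poly_char m n (f * h) = poly_char m n f * poly_char m n h.
Proof.
move=> fm hm; rewrite /poly_char psumM ?monic_neq0 // (psiD psiP) mulrACA -(mcharM omegaP).
congr (mchar _ _ * _); rewrite coef0M mulrACA -exprD; congr (_ ^+ _ * _).
rewrite size_mul ?monic_neq0 //.
move: (monic_neq0 fm) (monic_neq0 hm); rewrite -!size_poly_gt0.
by case: (size f) (size h) => [|a] [|b] //= _ _; rewrite addnS.
Qed.

(** * Norms, traces and characters of extension fields *)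

Section Extension.
Variables (L : finFieldType) (iota : {rmorphism F -> L}).
Local Notation phi := (frob iota).

(* [retract z] is junk ([0]) when [z] is not in the image of [iota]. *)
Definition retract (z : L) : F := odflt 0 [pick a | iota a == z].

Lemma retractK : cancel iota retract.
Proof.
move=> a; rewrite /retract; case: pickP => [b /eqP /fmorph_inj -> //|/(_ a)].
by rewrite eqxx.
Qed.

(** For [y] fixed by [iter j phi], the product and the sum of the conjugates are Frobenius
    invariant, hence lie in the image of [iota]: they are the norm and the trace from the extension
    of degree [j]. *)
Definition frob_norm j (y : L) : F := retract (\prod_(z <- traject phi y j) z).
Definition frob_trace j (y : L) : F := retract (\sum_(z <- traject phi y j) z).

Definition frob_char (m : int) (n j : nat) (y : L) : algC :=
  mchar m (frob_norm j y) * psi (frob_trace j (y ^+ n)).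

Lemma traject_frobX j n y : traject phi (y ^+ n) j = map (fun z => z ^+ n) (traject phi y j).
Proof. by elim: j y => //= j IH y; rewrite -IH rmorphXn. Qed.

Lemma poly_char_frob m n j y f : iter j phi y = y -> map_poly iota f = frob_prod iota j y ->
  poly_char m n f = frob_char m n j y.
Proof.
move=> fy Ef; rewrite /poly_char /frob_char /frob_norm /frob_trace.
have sf : size f = j.+1 by rewrite -(size_map_poly iota) Ef size_prod_XsubC size_traject.
rewrite traject_frobX big_map -psum_prod_XsubC -/(frob_prod iota j y) -Ef psum_map retractK.
congr (mchar _ _ * _); apply: (fmorph_inj iota); rewrite sf /=.
have E : iota ((-1) ^+ j * f`_0) = \prod_(z <- traject phi y j) z.
  rewrite rmorphM rmorphXn rmorphN1 -coef_map Ef coef0_prod_XsubC size_traject.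
  by rewrite mulrA -exprMn mulrNN mulr1 expr1n mul1r.
by rewrite -E retractK.
Qed.

Lemma prod_traject_frob j y : iter j phi y = y ->
  iota (frob_norm j y) = \prod_(z <- traject phi y j) z.
Proof.
move=> fy; rewrite /frob_norm; have [|a Ea] := @frob_fixed F L iota (\prod_(z <- traject phi y j) z).
  by rewrite rmorph_prod -(big_map phi xpredT id); apply: perm_big; apply: perm_traject_frob.
by rewrite Ea retractK.
Qed.

Lemma frob_normX j n y : iter j phi y = y -> frob_norm j (y ^+ n) = frob_norm j y ^+ n.
Proof.
move=> fy; apply: (fmorph_inj iota); rewrite rmorphXn !prod_traject_frob //; last first.
  by rewrite (iter_frob iota) exprAC -(iter_frob iota) fy.
by rewrite traject_frobX big_map prodrXl.
Qed.

Lemma frob_normE j y : iter j phi y = y ->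
  iota (frob_norm j y) = y ^+ (\sum_(i < j) #|F| ^ i).
Proof.
move=> fy; rewrite prod_traject_frob //.
rewrite expr_sum -(big_mkord xpredT (fun i => y ^+ (#|F| ^ i))).
rewrite (big_nth y) size_traject; apply: eq_big_nat => i /andP[_ ij].
by rewrite nth_traject // iter_frob.
Qed.

(** Group the [y] by x = y^n. The number of n-th roots of a nonzero x is n or 0, which is the sum
    over k < n of the powers z^k, where z is the value at the norm of x of a character of order n.
    Each k then gives one twisted sum with exponent 1. *)
Lemma frob_sum_poly_char (m : int) n j : (0 < n)%N -> (n %| q1)%N -> (0 < j)%N ->
  (exists s : seq L, map_poly iota ('X^(#|F| ^ j) - 'X) = \prod_(z <- s) ('X - z%:P)) ->
  frob_sum iota (frob_char (n%:Z * m) n) j =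
  \sum_(k < n) frob_sum iota (frob_char (m + (k * (q1 %/ n))%:Z) 1) j.
Proof.
move=> n0 nq j0 spl; rewrite /frob_sum.
have E y : iter j phi y == y -> frob_char (n%:Z * m) n j y = frob_char m 1 j (y ^+ n).
  move=> /eqP fy; rewrite /frob_char expr1 frob_normX //; congr (_ * _).
  have [->|N0] := eqVneq (frob_norm j y) 0; first by rewrite /mchar expr0n gtn_eqF // eqxx.
  by rewrite !mcharE ?expf_neq0 // (omegaX omegaP) // exprnP exprz_exp.
rewrite (eq_bigr _ E) (partition_big (fun y => y ^+ n) (fun x => iter j phi x == x)) /=; last first.
  by move=> y /eqP fy; rewrite (iter_frob iota) exprAC -(iter_frob iota) fy.
rewrite exchange_big /=; apply: eq_bigr => x /eqP fx.
rewrite (eq_bigr (fun=> frob_char m 1 j x)); last by move=> y /andP[_ /eqP ->].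
rewrite sumr_const.
(* At x = 0 the norm is 0, as [j > 0], and both sides vanish by the convention for [mchar] at 0. *)
have [x0|x0] := eqVneq x 0.
  have N0 : frob_norm j x = 0.
    apply: (fmorph_inj iota); rewrite rmorph0 prod_traject_frob // x0.
    by case: j j0 {spl E fx} => //= j _; rewrite big_cons mul0r.
  rewrite /frob_char N0 /mchar eqxx mul0r mul0rn big1 // => k _; by rewrite mul0r.
rewrite (_ : #|_| = #|[set y : L | (iter j phi y == y) && (y ^+ n == x)]|); last first.
  by apply: eq_card => y; rewrite !inE.
rewrite (card_nth_root_fixed n0 nq spl) //.
set N := frob_norm j x; have N0 : N != 0.
  by rewrite -(fmorph_eq0 iota) frob_normE // expf_neq0.
(* The norm is the power with exponent 1 + q + ... + q^(j-1), and this times (q-1)/n is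
   (q^j-1)/n. *)
have Nfr : (N ^+ (q1 %/ n) == 1) = (x ^+ ((#|F| ^ j).-1 %/ n) == 1).
  rewrite -(inj_eq (fmorph_inj iota)) rmorph1 rmorphXn frob_normE // -exprM.
  by rewrite predn_exp -divn_mulAC // [in RHS]mulnC.
set z := omega N ^+ (q1 %/ n).
have zE : (z == 1) = (N ^+ (q1 %/ n) == 1).
  rewrite /z -(omegaX omegaP) //; apply/eqP/eqP => [|->]; last exact: omega1.
  by apply: omega_inj1; rewrite ?expf_neq0.
have zn : z ^+ n = 1 by rewrite /z -exprM divnK // omega_card.
rewrite -Nfr -zE.
transitivity (frob_char m 1 j x * \sum_(k < n) z ^+ k).
  by rewrite sum_exp_unity //; case: ifP => _; rewrite ?mulr_natr ?mulr0.
rewrite mulr_sumr.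
apply: eq_bigr => k _; rewrite /frob_char !mcharE // mulrAC; congr (_ * _).
rewrite exprzDr ?(omega_unit omegaP) //; congr (_ * _).
by rewrite /z -exprM mulnC.
Qed.
End Extension.

Lemma monic_sum_poly_char0 m n : monic_sum (poly_char m n) 0 = 1.
Proof.
rewrite /monic_sum (bigD1 0) //= big1 => [|r]; last first.
  by rewrite -(inj_eq val_inj) -size_poly_eq0 -leqn0 size_npoly.
by rewrite addr0 expr0 addr0 /poly_char size_poly1 psum1 (psi0 psiP) coef1 mul1r mulr1 (mchar1 omegaP).
Qed.

(** In degree 1 the polynomials X - c give the Gauss sum. From degree 2 on, the subleading
    coefficient is not the constant term and enters only through [psi], so the sum vanishes by
    translating that coefficient. *)
Lemma monic_sum_poly_char1 (m : int) d :
  monic_sum (poly_char m 1) d = (1 + (g m)%:P * 'X)`_d.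
Proof.
rewrite coefD coef1 coefCM coefX.
case: d => [|[|d]] /=; first by rewrite mulr0 addr0 monic_sum_poly_char0.
  rewrite /monic_sum add0r mulr1 gaussE (reindex (fun c : F => npolyp 1 (- c)%:P)); last first.
    exists (fun r : {poly_1 F} => - (r : {poly F})`_0) => [c _|r _].
      by rewrite /= npolypK ?coefC ?opprK // (leq_trans (size_polyC_leq1 _)).
    apply/val_inj; rewrite /= opprK npolypK ?(leq_trans (size_polyC_leq1 _)) //.
    by rewrite -size1_polyC // size_npoly.
  apply: eq_bigr => c _; rewrite npolypK ?(leq_trans (size_polyC_leq1 _)) //.
  rewrite polyCN expr1 /poly_char psum_XsubC expr1 size_XsubC coefB coefX coefC /=.
  by rewrite sub0r expr1 mulN1r opprK.
rewrite /monic_sum mulr0 addr0; have [a pa] := psiN.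
have pa' : psi (- - a) - 1 != 0 by rewrite opprK subr_eq0.
apply: (mulIf pa'); rewrite mul0r mulrBr mulr1 mulr_suml; apply/eqP; rewrite subr_eq0; apply/eqP.
pose sh : {poly_d.+2 F} := npolyp d.+2 (- a *: 'X^(d.+1)).
have shE : sh = - a *: 'X^(d.+1) :> {poly F}.
  by rewrite npolypK // (leq_trans (size_scale_leq _ _)) // size_polyXn.
rewrite [RHS](reindex_inj (addIr sh)) /=; apply: eq_bigr => r _.
have [rm rs] := monic_Xn_add r; have [r'm r's] := monic_Xn_add (r + sh).
rewrite /poly_char rs r's (psum_one rm rs) (psum_one r'm r's) -mulrA -(psiD psiP) -opprD.
congr (mchar _ (_ * _) * psi (- _)); rewrite /= shE !coefD ?coefZ ?coefXn /=.
  by rewrite mulr0 addr0.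
by rewrite eqxx mulr1 addrA.
Qed.

(** By [psum_addC] the constant term c contributes a separate factor psi(-nc); the sum over the
    other coefficients is [C]. It is chosen before [m], so that its value can be read off from a
    single [m]. *)
Lemma monic_sum_poly_char_top n : (0 < n)%N -> n%:R != 0 :> F -> exists C : algC,
  forall m, monic_sum (poly_char (n%:Z * m) n) n = g (n%:Z * m) * omega n%:R ^ (- (n%:Z * m)) * C.
Proof.
move=> n0 nF.
exists (\sum_(r : {poly_n F} | (r : {poly F})`_0 == 0) psi (psum n ('X^n + (r : {poly F})))).
move=> m; rewrite /monic_sum (partition_big (fun r : {poly_n F} => (r : {poly F})`_0) predT) //=.
pose k (c : F) : {poly_n F} := npolyp n c%:P.
have kE c : k c = c%:P :> {poly F} by rewrite npolypK // (leq_trans (size_polyC_leq1 _)).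
transitivity (\sum_(c : F) mchar (n%:Z * m) ((-1) ^+ n * c) * psi (- (n%:R * c)) *
   \sum_(r : {poly_n F} | (r : {poly F})`_0 == 0) psi (psum n ('X^n + (r : {poly F})))).
  apply: eq_bigr => c _; rewrite (reindex_inj (addIr (k c))) /= mulr_sumr.
  apply: eq_big => [r|r /eqP].
    by rewrite kE coefD coefC /= -subr_eq0 addrK.
  rewrite kE coefD coefC /= => rc; have [rm rs] := monic_Xn_add r.
  have [r'm r's] := monic_Xn_add (r + k c); move: r'm r's; rewrite /= kE => r'm r's.
  rewrite /poly_char r's coefD coefXn coefD coefC /= rc.
  rewrite (_ : (0 == n)%N = false) ?add0r; last by rewrite eq_sym gtn_eqF.
  by rewrite addrA psum_addC // (psiD psiP) mulrA mulrAC -mulrA (mulrC (psi _)) mulrA.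
rewrite -mulr_suml; congr (_ * _).
have nN : - n%:R != 0 :> F by rewrite oppr_eq0.
rewrite gaussE mulr_suml [RHS](reindex_inj (mulfI nN)); apply: eq_bigr => c _.
rewrite mulrAC mulNr; congr (_ * _).
(* The sign (-1)^(n+1) has trivial character value because the exponent is a multiple of n and
   n(n+1) is even. *)
have -> : - (n%:R * c) = (-1) ^+ n * c * ((-1) ^+ n.+1 * n%:R).
  rewrite mulrACA -exprD addnS exprS addnn -mul2n exprM sqrrN !expr1n mulr1.
  by rewrite mulN1r mulrC.
have s0 : (-1) ^+ n.+1 != 0 :> F by rewrite signr_eq0.
rewrite !(mcharM omegaP) [mchar _ n%:R]mcharE // [mchar _ ((-1) ^+ n.+1)]mcharE //.
rewrite -[omega ((-1) ^+ n.+1) ^ _]exprz_exp -exprnP -(omegaX omegaP) // -exprM.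
have -> : (-1) ^+ (n.+1 * n) = 1 :> F by rewrite -signr_odd oddM /= andNb.
by rewrite (omega1 omegaP) exp1rz mul1r -!mulrA -exprzDr ?(omega_unit omegaP) // subrr mulr1.
Qed.

(** The last product is left unevaluated: in [hasse_davenport_quot] it cancels against the
    denominators. *)
Theorem hasse_davenport_product n (m : int) : (0 < n)%N -> (n %| q1)%N ->
  \prod_(k < n) g (m + (k * (q1 %/ n))%:Z) =
  - (g (n%:Z * m) * omega n%:R ^ (- (n%:Z * m)) * \prod_(k < n) g (k * (q1 %/ n))%:Z).
Proof.
move=> n0 nq; have nF := natr_dvd_card_neq0 nq.
have [C EC] := monic_sum_poly_char_top n0 nF.
have key m' : \prod_(k < n) g (m' + (k * (q1 %/ n))%:Z) =
    g (n%:Z * m') * omega n%:R ^ (- (n%:Z * m')) * C.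
  (* The size q^n + 1 covers the monic polynomials of degree at most n as well as the X^(q^j) - X
     for 0 < j <= n. *)
  rewrite -EC; have [L [iota spl]] := finField_split_ext F (#|F| ^ n).+1.
  have split_small d f : (d <= n)%N -> f \is monic -> (size f <= d.+1)%N ->
      exists s : seq L, map_poly iota f = \prod_(z <- s) ('X - z%:P).
    move=> dn fm sf; apply: spl => //; apply: leq_trans sf _; rewrite ltnS.
    by apply: leq_trans dn _; rewrite ltnW // ltn_expl // finNzRing_gt1.
  have split_frob j : (0 < j)%N -> (j <= n)%N -> exists s : seq L,
      map_poly iota ('X^(#|F| ^ j) - 'X) = \prod_(z <- s) ('X - z%:P).
    move=> j0 jn; have lt1 : (1 < #|F| ^ j)%N by rewrite -{1}(expn0 #|F|) ltn_exp2l ?finNzRing_gt1.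
    have sz : (size (- 'X : {poly F}) < size ('X^(#|F| ^ j) : {poly F}))%N.
      by rewrite size_polyN size_polyX size_polyXn ltnS.
    apply: spl; first by rewrite monicE lead_coefDl // lead_coefXn.
    by rewrite size_polyDl // size_polyXn ltnS leq_exp2l ?finNzRing_gt1.
  pose A (k : 'I_n) : {poly algC} := 1 + (g (m' + (k * (q1 %/ n))%:Z))%:P * 'X.
  have recA (k : 'I_n) : newton_rec n
      (frob_sum iota (frob_char iota (m' + (k * (q1 %/ n))%:Z) 1)) (fun d => (A k)`_d).
    move=> d dn; rewrite -monic_sum_poly_char1.
    rewrite (monic_sum_rec (poly_charM _ _) (@poly_char_frob _ iota _ _)); last by move=> f; apply: split_small.
    by apply: eq_bigr => j _; rewrite monic_sum_poly_char1.
  have recP := newton_rec_prod recA.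
  have recT : newton_rec n
       (fun j => \sum_(k < n) frob_sum iota (frob_char iota (m' + (k * (q1 %/ n))%:Z) 1) j)
       (monic_sum (poly_char (n%:Z * m') n)).
    move=> d dn.
    rewrite (monic_sum_rec (poly_charM _ _) (@poly_char_frob _ iota _ _)); last by move=> f; apply: split_small.
    apply: eq_big_nat => j /andP[j0 jd]; rewrite frob_sum_poly_char //.
    by apply: split_frob => //; apply: leq_trans dn.
  (* Both series satisfy the same recursion up to degree n and start with 1; their coefficients of
     degree n are the two sides of [key]. *)
  have <- := newton_rec_unique _ recP recT (leqnn n).
    by rewrite coef_prod_1addCX.
  rewrite monic_sum_poly_char0 -horner_coef0 horner_prod big1 // => k _.
  by rewrite !hornerE.
(* At m' = 0 the Gauss sum g(0) = -1 identifies [C]. *)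
have := key 0; rewrite mulr0 oppr0 expr0z mulr1 (gauss0 omega psiP psiN) mulN1r => E0.
rewrite key (eq_bigr (fun k : 'I_n => g (0 + (k * (q1 %/ n))%:Z))) => [|k _]; last by rewrite add0r.
by rewrite E0 mulrN opprK.
Qed.
End HasseDavenport.

(** * Multiplicities of roots of unity *)

Lemma mup_prod (K : fieldType) (I : finType) (f : I -> {poly K}) x :
  (forall i, f i != 0) -> mup x (\prod_i f i) = (\sum_i mup x (f i))%N.
Proof.
move=> f0; suff : mup x (\prod_i f i) = (\sum_i mup x (f i))%N /\ \prod_i f i != 0 by case.
elim/big_rec2: _ => [|i n p _ [<- p0]].
  by rewrite oner_neq0 mupNroot // root1.
by rewrite mupM ?mulf_neq0.
Qed.

Lemma mup_gcdp (K : fieldType) (f g : {poly K}) x : f != 0 -> g != 0 ->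
  mup x (gcdp f g) = minn (mup x f) (mup x g).
Proof.
move=> f0 g0; have d0 : gcdp f g != 0 by rewrite gcdp_eq0 (negPf f0).
have dv : ('X - x%:P) ^+ mup x (gcdp f g) %| gcdp f g by rewrite -mup_geq.
apply/eqP; rewrite eqn_leq leq_min !mup_geq // dvdp_gcd -!mup_geq // geq_minl geq_minr.
by rewrite !mup_geq // !(dvdp_trans dv) ?dvdp_gcdl ?dvdp_gcdr.
Qed.

Lemma mup_Xn_sub_1 n (z : algC) : (0 < n)%N -> mup z ('X^n - 1) = (z ^+ n == 1).
Proof.
move=> n0; have [w pw] := C_prim_root_exists n0.
rewrite -(factor_Xn_sub_1 pw) -(big_map (fun i => w ^+ i) xpredT (fun y => 'X - y%:P)) mu_prod_XsubC.
rewrite count_uniq_mem; last first.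
  rewrite map_inj_in_uniq ?iota_uniq // => i j; rewrite !mem_index_iota => /andP[_ li] /andP[_ lj] /eqP.
  by rewrite (eq_prim_root_expr pw) !modn_small // => /eqP.
congr nat_of_bool; apply/mapP/eqP => [[i _ ->]|/(prim_rootP pw)[i ->]].
  by rewrite -exprM mulnC exprM (prim_expr_order pw) expr1n.
by exists (i : nat) => //; rewrite mem_index_iota ltn_ord.
Qed.

Section RootMultiplicity.
Variable N : nat.
Hypothesis N0 : (0 < N)%N.
Local Notation e := (fun u : int => expi2pi (u%:~R / N%:R)).

Lemma divN_int (u : int) : ((u%:~R / N%:R : rat) \is a Num.int) = (N %| u)%Z.
Proof.
have NQ : (N%:R : rat) != 0 by rewrite pnatr_eq0 -lt0n.
apply/intrP/dvdzP => [[k Ek]|[k ->]]; exists k.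
  by apply: (@intr_inj rat); rewrite intrM -Ek -[(Posz N)%:~R]/(N%:R) divfK //.
by rewrite intrM -[(Posz N)%:~R]/(N%:R) mulfK //.
Qed.

Lemma expi2pi_div_eq (u v : int) : (e u == e v) = (N %| u - v)%Z.
Proof. by rewrite expi2pi_eq -mulrBl -intrB divN_int. Qed.

Lemma expi2pi_div_expr_eq1 (u : int) n : (e u ^+ n == 1) = (N %| n%:Z * u)%Z.
Proof. by rewrite expi2pi_expr_eq1 -divN_int intrM mulrAC [_ * n%:R]mulrC. Qed.

(** Multiplicities at N-th roots of unity become counts of congruences modulo [N], the form in which
    they appear as exponents in [prod_periodic]. *)
Lemma mup_prod_expi2pi d (a : 'I_d -> rat) (u : int) :
  (forall j, N%:R * a j \is a Num.int) ->
  mup (e u) (\prod_(j < d) ('X - (expi2pi (a j))%:P)) =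
  (\sum_(j < d) (N %| (Defs.ratz (a j * N%:R) - u)%R)%Z)%N.
Proof.
move=> aN; rewrite mup_prod => [|j]; last by rewrite polyXsubC_eq0.
apply: eq_bigr => j _; have /intrP[k Ek] := aN j; rewrite mulrC in Ek.
by rewrite /Defs.ratz Ek numq_int -expi2pi_div_eq -[X in mup _ X]expr1
  mup_XsubCX -Ek mulfK ?pnatr_eq0 -?lt0n //.
Qed.

Lemma mup_prod_Xn_sub_1 r (p : 'I_r -> nat) (u : int) : (forall i, (0 < p i)%N) ->
  mup (e u) (\prod_(i < r) ('X^(p i) - 1)) = (\sum_(i < r) (N %| ((p i)%:Z * u)%R)%Z)%N.
Proof.
move=> p0; rewrite mup_prod => [|i]; last by rewrite -size_poly_eq0 size_XnsubC.
by apply: eq_bigr => i _; rewrite mup_Xn_sub_1 // expi2pi_div_expr_eq1.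
Qed.
End RootMultiplicity.

(** * Reflection formula for Gauss sums *)

(** Carries an identity between multiplicities of roots over to products of values of any
    nonvanishing function of the roots. *)
Lemma prod_exp_cancel (K : fieldType) N (f : 'I_N -> K) (cA cB cP cQ : 'I_N -> nat) :
  (forall u, f u != 0) -> (forall u, (cA u + cQ u = cB u + cP u)%N) ->
  (\prod_u f u ^+ cA u) / (\prod_u f u ^+ cB u) = (\prod_u f u ^+ cP u) / (\prod_u f u ^+ cQ u).
Proof.
move=> f0 h; have nz c : \prod_u f u ^+ c u != 0 :> K.
  by apply/prodf_neq0 => u _; rewrite expf_neq0.
apply/eqP; rewrite eqr_div // -!big_split /=; apply/eqP; apply: eq_bigr => u _.
by rewrite -!exprD h addnC.
Qed.

Section Reflection.
Variables (F : finFieldType) (psi omega : F -> algC).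
Hypothesis psiP : is_add_char psi.
Hypothesis psiN : exists x, psi x != 1.
Hypothesis omegaP : generates_char_group omega.
Local Notation mchar := (mchar omega).
Local Notation g := (gauss psi omega).
Local Notation q1 := (#|F|.-1).

Lemma omega_exp_dvd (u : int) x : x != 0 -> (q1 %| u)%Z -> omega x ^ u = 1.
Proof.
move=> x0 /dvdzP[k ->]; have := omega_periodic omegaP 0 k x0.
by rewrite add0r expr0z.
Qed.

Lemma gauss_dvd (u : int) : (q1 %| u)%Z -> g u = -1.
Proof.
move=> /dvdzP[k ->]; have := gauss_periodic psi omegaP 0 k.
by rewrite add0r (gauss0 omega psiP psiN).
Qed.

Lemma sum_omega (u : int) : ~~ (q1 %| u)%Z -> \sum_(x | x != 0) omega x ^ u = 0.
Proof.
move=> nd; have [w pw] := finField_prim_root F.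
have w0 : w != 0.
  apply: contra_eq_neq (prim_expr_order pw) => ->.
  by rewrite expr0n gtn_eqF ?card_finField_pred_gt0 // eq_sym oner_neq0.
have wu : omega w ^ u != 1.
  apply: contra nd => /eqP; rewrite (divz_eq u q1) addrC (omega_periodic omegaP) //.
  have : (0 <= u %% q1)%Z by rewrite modz_ge0 // -lt0n card_finField_pred_gt0.
  have : ((u %% q1)%Z < q1%:Z) by rewrite ltz_pmod // ltz_nat card_finField_pred_gt0.
  case: (u %% q1)%Z => // r _ _; rewrite -exprnP -(omegaX omegaP) // => ow.
  apply: rpredD; last exact: dvdz_mull.
  rewrite -[X in is_true X]/(q1 %| r)%N (prim_order_dvd pw); apply/eqP.
  by apply: omega_inj1 ow; rewrite ?expf_neq0.
have wu' : omega w ^ u - 1 != 0 by rewrite subr_eq0.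
apply: (mulIf wu'); rewrite mul0r mulrBr mulr1 mulr_suml; apply/eqP; rewrite subr_eq0; apply/eqP.
rewrite [RHS](reindex_inj (mulIf w0)) /=; apply: eq_big => x.
  by rewrite mulf_eq0 (negPf w0) orbF.
by move=> x0; rewrite (omegaM omegaP) // exprzMl ?(omega_unit omegaP).
Qed.

(* Substitute x = z y in the double sum and sum over y first. *)
Lemma gauss_reflection (u : int) :
  g u * g (- u) = omega (-1) ^ u * #|F|%:R ^+ (~~ (q1 %| u)%Z).
Proof.
have N10 : (-1 : F) != 0 by rewrite oppr_eq0 oner_eq0.
have [du|nd] := boolP (q1 %| u)%Z.
  by rewrite (gauss_dvd du) gauss_dvd ?rpredN // mulrNN mulr1 omega_exp_dvd // mulr1.
rewrite /=.
transitivity (\sum_(x | x != 0) omega x ^ u * \sum_(y | y != 0) psi ((x + 1) * y)).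
  rewrite [X in X * _]/gauss mulrC /gauss mulr_suml.
  under [RHS]eq_bigr do rewrite mulr_sumr.
  rewrite [RHS]exchange_big /=; apply: eq_bigr => y y0.
  rewrite mulr_sumr (reindex_inj (mulIf y0)) /=; apply: eq_big => x.
    by rewrite mulf_eq0 (negPf y0) orbF.
  rewrite mulf_eq0 (negPf y0) orbF => x0.
  rewrite (omegaM omegaP) // exprzMl ?(omega_unit omegaP) //.
  rewrite mulrDl mul1r (psiD psiP).
  have E : omega y ^ (- u) * omega y ^ u = 1.
    by rewrite -exprzDr ?(omega_unit omegaP) // addNr expr0z.
  transitivity (omega y ^ (- u) * omega y ^ u * (omega x ^ u * (psi (x * y) * psi y))).
    by ring.
  by rewrite E mul1r.
(* The sum over all y is q at x = -1 and 0 elsewhere; the -1 removes y = 0 and later disappears by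
   [sum_omega]. *)
have inner (x : F) : \sum_(y | y != 0) psi ((x + 1) * y) = (if x == -1 then #|F|%:R else 0) - 1.
  have : \sum_y psi ((x + 1) * y) = if x == -1 then #|F|%:R else 0.
    rewrite -subr_eq0 opprK; case: eqP => [->|/eqP x1]; last exact: sum_psi.
    by rewrite (eq_bigr (fun=> 1)) ?sumr_const // => y _; rewrite mul0r psi0.
  by rewrite (bigD1 0) //= mulr0 psi0 // => <-; rewrite addrC addrK.
rewrite (eq_bigr _ (fun x _ => congr1 (fun z => omega x ^ u * z) (inner x))).
under eq_bigr do rewrite mulrBr mulr1.
rewrite sumrB sum_omega // subr0 (bigD1 (-1)) //= eqxx big1 ?addr0 // => x /andP[_ /negPf ->].
by rewrite mulr0.
Qed.

Lemma gauss_neq0 u : g u != 0.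
Proof.
have : g u * g (- u) != 0; last by rewrite mulf_eq0 => /norP[].
rewrite gauss_reflection mulf_neq0 //.
  by rewrite expfz_neq0 // (omega_neq0 omegaP) // oppr_eq0 oner_eq0.
by rewrite expf_neq0 // pnatr_eq0 -lt0n ltnW ?finNzRing_gt1.
Qed.
End Reflection.

(** * Hypergeometric sums *)

Section HypergeometricTerm.
Variables (F : finFieldType) (psi omega : F -> algC).
Hypothesis psiP : is_add_char psi.
Hypothesis psiN : exists x, psi x != 1.
Hypothesis omegaP : generates_char_group omega.
Local Notation g := (gauss psi omega).
Local Notation q1 := (#|F|.-1).
Local Notation q := (#|F|%:R : algC).

Lemma omega_prod n (f : 'I_n -> F) : (forall i, f i != 0) ->
  omega (\prod_i f i) = \prod_i omega (f i).
Proof.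
move=> f0; suff : omega (\prod_i f i) = \prod_i omega (f i) /\ \prod_i f i != 0 by case.
elim/big_rec2: _ => [|i x y _ [<- y0]]; first by rewrite (omega1 omegaP) oner_neq0.
by rewrite (omegaM omegaP) ?mulf_neq0.
Qed.

Lemma prod_exprz n (x : algC) (f : 'I_n -> int) : x != 0 ->
  \prod_i x ^ f i = x ^ (\sum_i f i).
Proof.
by move=> x0; rewrite (big_morph _ (fun a b => expfzDr a b x0) (expr0z x)).
Qed.

Lemma prod_exprzl n (f : 'I_n -> algC) (z : int) : (\prod_i f i) ^ z = \prod_i f i ^ z.
Proof. by rewrite (big_morph (fun x => x ^ z) (fun x y => expfzMl x y z) (exp1rz _ z)). Qed.

(** Each factor depends only on the residue of [a j] modulo q - 1; the factors are grouped by
    residue. *)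
Lemma prod_periodic (f : int -> algC) d (a : 'I_d -> int) :
  (forall u k : int, f (u + k * q1%:Z) = f u) ->
  \prod_(j < d) f (a j) = \prod_(u < q1) f u%:Z ^+ (\sum_(j < d) (q1 %| (a j - u%:Z)%R)%Z).
Proof.
move=> per; have q10 := card_finField_pred_gt0 F.
under [RHS]eq_bigr do rewrite expr_sum.
rewrite exchange_big /=; apply: eq_bigr => j _.
have r0 : (0 <= a j %% q1)%Z by rewrite modz_ge0 // -lt0n.
have rq : ((a j %% q1)%Z < q1%:Z) by rewrite ltz_pmod.
case Er : (a j %% q1)%Z r0 rq => [r|//] _ rq; rewrite ltz_nat in rq.
rewrite (bigD1 (Ordinal rq)) //= big1 => [|u ur].
  have E : a j = r%:Z + (a j %/ q1)%Z * q1%:Z by rewrite -Er addrC -divz_eq.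
  by rewrite mulr1 {2}E addrAC subrr add0r dvdz_mull // expr1 E per.
case: (boolP (_ %| _)%Z) => // dv; case/negP: ur; apply/eqP/val_inj => /=.
move: dv; rewrite -eqz_mod_dvd Er => /eqP [].
by rewrite modz_small ?ltz_nat ?ltn_ord //= => [[->]].
Qed.

Lemma gauss_quot_periodic m (u k : int) :
  g (m + (u + k * q1%:Z)) / g (u + k * q1%:Z) = g (m + u) / g u.
Proof. by rewrite addrA !(gauss_periodic psi omegaP). Qed.

(** The residues [u] killed by [n] modulo q - 1 are the k (q-1)/n with k < n. *)
Lemma hasse_davenport_quot n (m : int) : (0 < n)%N -> (n %| q1)%N ->
  \prod_(u < q1 | (q1 %| (n%:Z * u%:Z)%R)%Z) (g (m + u%:Z) / g u%:Z) =
  - (g (n%:Z * m) * omega n%:R ^ (- (n%:Z * m))).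
Proof.
move=> n0 nq; have q10 := card_finField_pred_gt0 F; set c := (q1 %/ n)%N.
have Ec : (c * n = q1)%N by rewrite divnK.
have c0 : (0 < c)%N by move: q10; rewrite -Ec muln_gt0 => /andP[].
have lt (k : 'I_n) : (k * c < q1)%N by rewrite -Ec mulnC ltn_pmul2l.
have lt' (u : 'I_q1) : (u %/ c < n)%N by rewrite ltn_divLR // mulnC Ec.
rewrite (reindex (fun k => Ordinal (lt k))) /=; last first.
  exists (fun u => Ordinal (lt' u)) => [k _|u dv]; apply: val_inj; rewrite /= ?mulnK //.
  have {dv} : (q1 %| n * u)%N by [].
  by rewrite -[X in (X %| _)%N]Ec mulnC dvdn_pmul2l // => cu; rewrite divnK.
have nz k : g k != 0 by apply: gauss_neq0.
rewrite (eq_bigl predT) => [|k]; last first.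
  by rewrite -[LHS]/(q1 %| n * (k * c))%N mulnCA (mulnC n) Ec dvdn_mull.
have := hasse_davenport_product psiP psiN omegaP m n0 nq.
rewrite -/c big_split /= prodfV => ->; rewrite -mulNr mulfK //.
by apply/prodf_neq0.
Qed.

Lemma prod_hasse_davenport_quot r (p : 'I_r -> nat) (m : int) :
  (forall i, (0 < p i)%N) -> (forall i, (p i %| q1)%N) ->
  \prod_(u < q1) (g (m + u%:Z) / g u%:Z) ^+ (\sum_(i < r) (q1 %| ((p i)%:Z * u%:Z)%R)%Z) =
  (-1) ^+ r * \prod_(i < r) g ((p i)%:Z * m) * \prod_(i < r) omega (p i)%:R ^ (- ((p i)%:Z * m)).
Proof.
move=> p0 pq; rewrite -mulrA -big_split /= -[X in _ ^+ X]card_ord -prodrN.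
under eq_bigr do rewrite expr_sum.
rewrite exchange_big /=; apply: eq_bigr => i _; rewrite -hasse_davenport_quot //.
by rewrite [RHS]big_mkcond; apply: eq_bigr => u _; case: (_ %| _)%Z.
Qed.

(** Reflection at m + b and at b. The factor q is missing exactly when q - 1 divides the argument,
    whence a difference of two indicators as exponent. *)
Lemma gauss_opp_quot (m b : int) :
  g (- m - b) / g (- b) =
  omega (-1) ^ m * q ^ ((q1 %| b)%Z%:Z - (q1 %| (b + m)%R)%Z%:Z) / (g (m + b) / g b).
Proof.
have q0 : q != 0 by rewrite pnatr_eq0 -lt0n ltnW ?finNzRing_gt1.
have N10 : (-1 : F) != 0 by rewrite oppr_eq0 oner_eq0.
have nz := gauss_neq0 psiP psiN omegaP.
have rf v : g (- v) = omega (-1) ^ v * q ^+ (~~ (q1 %| v)%Z) / g v.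
  by apply: (mulfI (nz v)); rewrite gauss_reflection // [RHS]mulrC divfK.
have -> : - m - b = - (m + b) by rewrite opprD.
rewrite !rf (addrC b) exprzDr ?(omega_unit omegaP) //.
have w0 : omega (-1) ^ b != 0 by rewrite expfz_neq0 // (omega_neq0 omegaP).
have -> : q ^ ((q1 %| b)%Z%:Z - (q1 %| (m + b)%R)%Z%:Z) =
   q ^+ (~~ (q1 %| (m + b)%R)%Z) / q ^+ (~~ (q1 %| b)%Z).
  by do 2 case: (_ %| _)%Z; rewrite /= ?subrr ?expr0z ?subr0 ?sub0r ?expr0 ?expr1 ?divr1 ?divff ?div1r.
by field; rewrite !nz w0 expf_neq0.
Qed.

Lemma hypergeometric_term d (a b : 'I_d -> int) (m : int) :
  \prod_(j < d) (g (m + a j) * g (- m - b j) / (g (a j) * g (- b j))) =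
  (omega (-1) ^ m) ^+ d *
  q ^ ((\sum_(j < d) (q1 %| b j)%Z)%N%:Z - (\sum_(j < d) (q1 %| (b j + m)%R)%Z)%N%:Z) *
  ((\prod_(j < d) (g (m + a j) / g (a j))) / (\prod_(j < d) (g (m + b j) / g (b j)))).
Proof.
have q0 : q != 0 by rewrite pnatr_eq0 -lt0n ltnW ?finNzRing_gt1.
rewrite !(big_morph Posz PoszD (erefl (0%N%:Z))) -sumrB -prod_exprz // -prodfV.
have -> : (omega (-1) ^ m) ^+ d = \prod_(j < d) omega (-1) ^ m by rewrite prodr_const card_ord.
rewrite -!big_split /=; apply: eq_bigr => j _.
transitivity (g (- m - b j) / g (- b j) * (g (m + a j) / g (a j))).
  by rewrite invfM; ring.
by rewrite gauss_opp_quot; ring.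
Qed.

End HypergeometricTerm.

(** * Term by term comparison of the two sums *)

Theorem mainTheorem2
  (d : nat) (alpha beta : 'I_d -> rat)
  (r s : nat) (p : 'I_r -> nat) (qq : 'I_s -> nat)
  (F : finFieldType) (psi omega : F -> algC) :
  (forall i j, alpha i - beta j \isn't a Num.int) ->
  (forall i, (0 < p i)%N) -> (forall j, (0 < qq j)%N) ->
  gcdn (\big[gcdn/0%N]_(i < r) p i) (\big[gcdn/0%N]_(j < s) qq j) = 1%N ->
  (* prod_j (X - e(alpha_j))/(X - e(beta_j)) = prod_i (X^{p_i}-1) / prod_j (X^{q_j}-1),
     as an identity of rational functions (cross-multiplied) *)
  (\prod_(j < d) ('X - (expi2pi (alpha j))%:P)) * \prod_(j < s) ('X^(qq j) - 1)
    = (\prod_(j < d) ('X - (expi2pi (beta j))%:P)) * \prod_(i < r) ('X^(p i) - 1)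
    :> {poly algC} ->
  is_add_char psi -> (exists x, psi x != 1) ->
  generates_char_group omega ->
  (forall i, ((#|F|.-1)%:R * alpha i : rat) \is a Num.int) ->
  (forall j, ((#|F|.-1)%:R * beta j : rat) \is a Num.int) ->
  (forall i, (p i %| #|F|.-1)%N) -> (forall j, (qq j %| #|F|.-1)%N) ->
  let q := #|F| in
  let g := gauss psi omega in
  let M : F := (\prod_(i < r) (p i)%:R ^+ p i) / (\prod_(j < s) (qq j)%:R ^+ qq j) in
  let eps : F := (-1) ^+ (\sum_(j < s) qq j) in
  let D : {poly algC} :=
    gcdp (\prod_(i < r) ('X^(p i) - 1)) (\prod_(j < s) ('X^(qq j) - 1)) in
  let smul (m : nat) : nat := mup (expi2pi (m%:Q / (q.-1)%:Q)) D in
  forall t : F, t != 0 ->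
  Hq psi omega alpha beta t =
    (-1) ^+ (r + s) / (1 - q%:R) *
    \sum_(0 <= m < q.-1)
      (q%:R ^ ((smul m)%:Z - (smul 0%N)%:Z) *
       (\prod_(i < r) g ((p i)%:Z * m%:Z)) *
       (\prod_(j < s) g (- ((qq j)%:Z * m%:Z))) *
       omega (eps * M^-1 * t) ^ (m%:Z)).
Proof.
move=> ab p0 qq0 _ polyE psiP psiN omegaP aN bN pq qqq q g M eps D smul t t0.
set N := #|F|.-1 in aN bN pq qqq *; have N0 : (0 < N)%N := card_finField_pred_gt0 F.
pose a j := Defs.ratz (alpha j * N%:R); pose b j := Defs.ratz (beta j * N%:R).
(* The multiplicities of e^(2 pi i u/(q-1)) as a root of the four products in the polynomial
   identity. *)
pose cA (u : int) : nat := (\sum_(j < d) (N %| (a j - u)%R)%Z)%N.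
pose cB (u : int) : nat := (\sum_(j < d) (N %| (b j - u)%R)%Z)%N.
pose cP (u : int) : nat := (\sum_(i < r) (N %| ((p i)%:Z * u)%R)%Z)%N.
pose cQ (u : int) : nat := (\sum_(j < s) (N %| ((qq j)%:Z * u)%R)%Z)%N.
have Xn1 n (f : 'I_n -> nat) : (forall i, (0 < f i)%N) ->
    \prod_(i < n) ('X^(f i) - 1) != 0 :> {poly algC}.
  by move=> f0; apply/prodf_neq0 => i _; rewrite -size_poly_eq0 size_XnsubC.
have Xs (c : 'I_d -> rat) : \prod_(j < d) ('X - (expi2pi (c j))%:P) != 0 :> {poly algC}.
  by apply/prodf_neq0 => j _; rewrite polyXsubC_eq0.
have mult u : (cA u + cQ u = cB u + cP u)%N.
  have := congr1 (mup (expi2pi (u%:~R / N%:R))) polyE; rewrite !mupM ?Xn1 ?Xs //.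
  by rewrite !mup_prod_expi2pi // !mup_prod_Xn_sub_1.
have smulE m : smul m = minn (cP m%:Z) (cQ m%:Z).
  by rewrite /smul /D mup_gcdp ?Xn1 //; congr minn; apply: mup_prod_Xn_sub_1.
have disj u : cA u = 0%N \/ cB u = 0%N.
  have [->|/eqP A0] := eqVneq (cA u) 0%N; first by left.
  have [->|/eqP B0] := eqVneq (cB u) 0%N; first by right.
  exfalso; have ex (c : 'I_d -> int) : (\sum_(j < d) (N %| (c j - u)%R)%Z)%N <> 0%N ->
    exists j, (N %| c j - u)%Z.
    move=> /eqP; rewrite sum_nat_eq0 negb_forall => /existsP[j].
    by rewrite /= eqb0 negbK => h; exists j.
  have [i ai] := ex _ A0; have [j bj] := ex _ B0.
  have := ab i j; rewrite -expi2pi_eq.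
  have e (c : rat) : N%:R * c \is a Num.int -> c = (Defs.ratz (c * N%:R))%:~R / N%:R.
    move=> /intrP[k Ek]; rewrite mulrC in Ek.
    by rewrite /Defs.ratz Ek numq_int -Ek mulfK // pnatr_eq0 -lt0n.
  rewrite (e _ (aN i)) (e _ (bN j)) -/(a i) -/(b j) expi2pi_div_eq // => /negP; apply.
  have -> : a i - b j = (a i - u) - (b j - u) by ring.
  by rewrite rpredB.
(* If [cA u = 0] the minimum is [cP u]; if [cB u = 0] it is [cQ u]. So [D] is what remains of the
   product over [qq] once the roots coming from [beta] are removed. *)
have cQE u : cQ u = (cB u + minn (cP u) (cQ u))%N.
  by move: (mult u); case: (disj u) => ->; lia.
have cPN u : cP (- u) = cP u by apply: eq_bigr => i _; rewrite mulrN rpredN.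
have cQN u : cQ (- u) = cQ u by apply: eq_bigr => i _; rewrite mulrN rpredN.
have cQ0 : cQ 0 = s.
  by rewrite /cQ (eq_bigr (fun=> 1%N)) ?sum1_card ?card_ord // => j _; rewrite mulr0 dvdz0.
have q0 : q%:R != 0 :> algC by rewrite pnatr_eq0 -lt0n ltnW ?finNzRing_gt1.
have N10 : (-1 : F) != 0 by rewrite oppr_eq0 oner_eq0.
have gnz u : g u != 0 by apply: gauss_neq0.
rewrite /Hq -/q -/N -/g [(-1) ^+ (r + s) / _]mulrC -[RHS]mulrA; congr (_ * _).
rewrite mulr_sumr; apply: eq_big_nat => m _.
rewrite -/a -/b (hypergeometric_term psiP psiN omegaP).
have per (u k : int) : g (m%:Z + (u + k * N%:Z)) / g (u + k * N%:Z) = g (m%:Z + u) / g u.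
  exact: gauss_quot_periodic.
rewrite (prod_periodic (f := fun u => g (m%:Z + u) / g u) a per).
rewrite (prod_periodic (f := fun u => g (m%:Z + u) / g u) b per).
(* Passage from the exponents of [alpha] and [beta] to those of the X^(p_i) - 1 and X^(q_j) - 1,
   applied to g(m + u) / g(u). *)
rewrite (prod_exp_cancel (cP := fun u => cP u%:Z) (cQ := fun u => cQ u%:Z)) => [|u|u]; first last.
- exact: mult.
- by rewrite mulf_neq0 // invr_eq0.
rewrite !prod_hasse_davenport_quot //.
rewrite -[#|F|%:R]/(q%:R) -/N -/g.
(* By [cQE] at 0 and at -m, [cB 0 - cB (- m)] is [smul m - smul 0] plus s - [cQ m]. The latter
   counts the j with [N] not dividing [qq j * m], that is the powers of q arising in the reflection
   [gneg]. *)
have qexp : q%:R ^ ((\sum_(j < d) (N %| Defs.ratz (beta j * N%:R))%Z)%N%:Z -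
      (\sum_(j < d) (N %| (Defs.ratz (beta j * N%:R) + m%:Z)%R)%Z)%N%:Z) =
    q%:R ^ ((smul m)%:Z - (smul 0%N)%:Z) *
    \prod_(j < s) q%:R ^+ (~~ (N %| ((qq j)%:Z * m%:Z)%R)%Z) :> algC.
  have B0 : (\sum_(j < d) (N %| Defs.ratz (beta j * N%:R))%Z)%N = cB 0.
    by apply: eq_bigr => j _; rewrite subr0.
  have Bm : (\sum_(j < d) (N %| (Defs.ratz (beta j * N%:R) + m%:Z)%R)%Z)%N = cB (- m%:Z).
    by apply: eq_bigr => j _; rewrite opprK.
  have Em : (\sum_(j < s) ~~ (N %| ((qq j)%:Z * m%:Z)%R)%Z + cQ m%:Z = s)%N.
    rewrite /cQ -big_split /= (eq_bigr (fun=> 1%N)) ?sum1_card ?card_ord // => j _.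
    by case: (_ %| _)%Z.
  rewrite B0 Bm -expr_sum exprnP -expfzDr // !smulE; congr (_ ^ _).
  set E := (\sum_i _)%N; have {}Em : (E + cQ m%:Z = s)%N := Em.
  have := cQE 0; have := cQE (- m%:Z); rewrite cPN cQN cQ0.
  move: (cP m%:Z) (cQ m%:Z) (cB 0) (cB (- m%:Z)) (cP 0) E Em => pm qm b0 bm cp0 E Em h1 h2.
  by lia.
rewrite {}qexp.
(* The product formula puts g(q_j m) in the denominator; reflection turns these into the g(-q_j m)
   of the claim. *)
have gneg : \prod_(j < s) g (- ((qq j)%:Z * m%:Z)) =
    \prod_(j < s) omega (-1) ^ ((qq j)%:Z * m%:Z) *
    \prod_(j < s) q%:R ^+ (~~ (N %| ((qq j)%:Z * m%:Z)%R)%Z) / \prod_(j < s) g ((qq j)%:Z * m%:Z).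
  rewrite -prodfV -!big_split /=; apply: eq_bigr => j _.
  by apply: (mulfI (gnz ((qq j)%:Z * m%:Z))); rewrite gauss_reflection // [RHS]mulrC divfK.
have pF i : (p i)%:R != 0 :> F by apply: natr_dvd_card_neq0.
have qF j : (qq j)%:R != 0 :> F by apply: natr_dvd_card_neq0.
have prodF n (f : 'I_n -> nat) : (forall i, (f i)%:R != 0 :> F) ->
    \prod_(i < n) ((f i)%:R : F) ^+ f i != 0.
  by move=> f0; apply/prodf_neq0 => i _; rewrite expf_neq0.
have oprod n (f : 'I_n -> nat) : (forall i, (f i)%:R != 0 :> F) ->
    omega (\prod_(i < n) ((f i)%:R : F) ^+ f i) ^ m%:Z = \prod_(i < n) omega (f i)%:R ^ ((f i)%:Z * m%:Z).
  move=> f0; rewrite omega_prod // => [|i]; last by rewrite expf_neq0.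
  by rewrite prod_exprzl; apply: eq_bigr => i _; rewrite (omegaX omegaP) // exprnP exprz_exp.
have omegaV x : x != 0 -> omega x^-1 = (omega x)^-1.
  move=> x0; apply: (mulfI (omega_neq0 omegaP x0)).
  by rewrite -(omegaM omegaP) ?invr_eq0 // !divff ?(omega1 omegaP) ?(omega_neq0 omegaP).
have oE : omega (eps * M^-1 * t) ^ m%:Z =
    \prod_(j < s) omega (-1) ^ ((qq j)%:Z * m%:Z) *
    (\prod_(j < s) omega (qq j)%:R ^ ((qq j)%:Z * m%:Z) /
     \prod_(i < r) omega (p i)%:R ^ ((p i)%:Z * m%:Z)) * omega t ^ m%:Z.
  have eps0 : eps != 0 by rewrite signr_eq0.
  have P0 := prodF _ _ pF; have Q0 := prodF _ _ qF.
  rewrite /M invf_div (omegaM omegaP) ?mulf_neq0 ?invr_eq0 // (omegaM omegaP) ?mulf_neq0 ?invr_eq0 //.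
  rewrite (omegaM omegaP) ?invr_eq0 // omegaV // !expfzMl exprz_inv -invr_expz !oprod //.
  congr (_ * _ * _); rewrite /eps (omegaX omegaP) // exprnP exprz_exp prod_exprz.
    by rewrite (big_morph Posz PoszD (erefl (0%N%:Z))) mulr_suml.
  exact: omega_neq0.
rewrite oE gneg.
have omega_oppn n (f : 'I_n -> nat) : \prod_(i < n) omega (f i)%:R ^ (- ((f i)%:Z * m%:Z)) =
    (\prod_(i < n) omega (f i)%:R ^ ((f i)%:Z * m%:Z))^-1.
  by rewrite -prodfV; apply: eq_bigr => i _; rewrite -invr_expz.
rewrite !omega_oppn.
have sq1 z : omega (-1) ^ z * omega (-1) ^ z = 1.
  by rewrite -expfzMl -(omegaM omegaP) // mulrNN mulr1 (omega1 omegaP) exp1rz.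
have Wsq :
    \prod_(j < s) omega (-1) ^ ((qq j)%:Z * m%:Z) * \prod_(j < s) omega (-1) ^ ((qq j)%:Z * m%:Z) = 1.
  by rewrite -big_split big1 // => j _; apply: sq1.
have wd : (omega (-1) ^ m%:Z) ^+ d * (omega (-1) ^ m%:Z) ^+ d = 1.
  by rewrite -exprMn sq1 expr1n.
have -> : omega ((-1) ^+ d * t) ^ m%:Z = (omega (-1) ^ m%:Z) ^+ d * omega t ^ m%:Z.
  rewrite (omegaM omegaP) ?signr_eq0 // expfzMl (omegaX omegaP) //.
  by rewrite exprnP exprzAC.
have nzP : \prod_(i < r) omega (p i)%:R ^ ((p i)%:Z * m%:Z) != 0.
  by apply/prodf_neq0 => i _; rewrite expfz_neq0 // (omega_neq0 omegaP).
have nzQ : \prod_(i < s) omega (qq i)%:R ^ ((qq i)%:Z * m%:Z) != 0.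
  by apply/prodf_neq0 => i _; rewrite expfz_neq0 // (omega_neq0 omegaP).
have nzG : \prod_(i < s) g ((qq i)%:Z * m%:Z) != 0 by apply/prodf_neq0.
rewrite exprD; have s2 : ((-1) ^+ s : algC)^-1 = (-1) ^+ s by rewrite -exprVn invrN1.
move: wd Wsq nzP nzQ nzG s2.
set w := (omega (-1) ^ m%:Z) ^+ d; set W := \prod_(j < s) omega (-1) ^ _.
set Pw := \prod_(i < r) omega _ ^ _; set Qw := \prod_(i < s) omega (qq i)%:R ^ _.
set Qg := \prod_(i < s) g _; set Pg := \prod_(i < r) g _; set qs := \prod_(j < s) _ ^+ _.
set qe := _ ^ (_ - _); set ot := omega t ^ _; set er := (-1) ^+ r; set es := (-1) ^+ s.
move=> wd Wsq nzP nzQ nzG s2.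
rewrite !invfM invrK s2.
(* The sign [w] occurs twice on the left, from the reflections and from (-1)^d t; [W] occurs twice
   on the right, from [gneg] and from [eps]. Both squares are 1. *)
transitivity ((w * w) * (er * es * (qe * Pg * qs / Qg * Qw / Pw * ot))); first by ring.
transitivity ((W * W) * (er * es * (qe * Pg * qs / Qg * Qw / Pw * ot))); last by ring.
by rewrite wd Wsq.
Qed.
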